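(* If $d>0$, $\upsilon>0$, $c,l,t\in\mathbb{C}$, $\mathfrak{a}\neq d$ and $l>-\frac{3}{2}$, then the solution of the equation $$N(t)-N_{0}\,\mathtt{S}_{l,c}^{\mathtt{k}}\left(d^{\upsilon}t^{\upsilon}\right)=-\mathfrak{a}^{\upsilon}\;{}_{0}D_{t}^{-\upsilon}N(t)$$ is given by the formula $$N(t)=N_{0}\sum_{r=0}^{\infty}\frac{(-c)^{r}\,\Gamma\left(2r\upsilon+\upsilon l+\upsilon+1\right)}{\Gamma_{\mathtt{k}}\left(r\mathtt{k}+l+\frac{3}{2}\mathtt{k}\right)\Gamma\left(r+\frac{3}{2}\right)}\left(\frac{d^{\upsilon}}{2}\right)^{2r+l+1}t^{\upsilon(2r+l+1)}\,E_{\upsilon,\,2r\upsilon+l\upsilon+\upsilon+1}\left(-\mathfrak{a}^{\upsilon}t^{\upsilon}\right).$$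
   Context: $N_0$ is a constant and $N(t)$ is the unknown function. $\Gamma_{\mathtt{k}}$ is the $\mathtt{k}$-gamma function ($\mathtt{k}>0$), $\Gamma_{\mathtt{k}}(x)=\mathtt{k}^{\frac{x}{\mathtt{k}}-1}\Gamma(x/\mathtt{k})$. The $\mathtt{k}$-Struve function is $$\mathtt{S}_{\nu,c}^{\mathtt{k}}(x)=\sum_{r=0}^{\infty}\frac{(-c)^r}{\Gamma_{\mathtt{k}}\left(r\mathtt{k}+\nu+\frac{3\mathtt{k}}{2}\right)\Gamma\left(r+\frac{3}{2}\right)}\left(\frac{x}{2}\right)^{2r+\frac{\nu}{\mathtt{k}}+1}.$$ The Riemann-Liouville fractional integral is ${}_{0}D_{t}^{-\upsilon}f(t)=\frac{1}{\Gamma(\upsilon)}\int_{0}^{t}(t-s)^{\upsilon-1}f(s)\,ds$, $\mathcal{R}(\upsilon)>0$. The generalized Mittag-Leffler function is $E_{\alpha,\beta}(x)=\sum_{n=0}^{\infty}\frac{x^{n}}{\Gamma(\alpha n+\beta)}$.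
   Formalization: In the formula, l is replaced by l/k in both exponents, in the numerator Gamma and in the index of E (the printed form fails for k≠1, l≠0); υ(Re l/k+1)>-1 is added so the fractional integral exists; t≠0 with -π<υ arg t≤π, principal powers. *)

(* Defs.v *)
From HB Require Import structures.
From mathcomp Require Import all_boot all_order all_algebra.
From mathcomp Require Import complex.
From mathcomp Require Import all_classical all_reals all_analysis.

Set Implicit Arguments.
Unset Strict Implicit.
Unset Printing Implicit Defensive.

Import Order.TTheory GRing.Theory Num.Theory.
Import numFieldNormedType.Exports.

Local Open Scope classical_set_scope.
Local Open Scope ring_scope.
Local Open Scope complex_scope.

Section ComplexFunctions.
Context {R : realType}.
Local Notation C := R[i].

(* [R[i]^o] is [R[i]] with the topology of its modulus. *)
Definition csummable (u : nat -> C) : Prop := cvgn (series (u : nat -> C^o)).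
Definition csum (u : nat -> C) : C := limn (series (u : nat -> C^o)).

Definition cexp (z : C) : C :=
  (expR (complex.Re z))%:C * (cos (complex.Im z) +i* sin (complex.Im z)).

(* Principal argument, in ]-pi, pi] for z != 0. *)
Definition carg (z : C) : R :=
  let th := acos (complex.Re z / Normc.normc z) in
  if 0 <= complex.Im z then th else - th.

(* Principal logarithm, for z != 0. *)
Definition clog (z : C) : C := ln (Normc.normc z) +i* carg z.

(* Principal power, extended by 0^0 = 1 and 0^w = 0 for w != 0. *)
Definition cpow (z w : C) : C :=
  if z == 0 then (w == 0)%:R else cexp (w * clog z).

(* Gauss's product formula, valid on the whole plane.  At the poles
   0, -1, -2, ... the sequence is eventually 0, so that [(Gamma z)^-1] is
   everywhere the entire function 1/Gamma. *)
Definition Gamma (z : C) : C :=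
  limn ((fun n : nat =>
    n`!%:R * cpow n%:R z / \prod_(i < n.+1) (z + i%:R)) : nat -> C^o).

Definition kGamma (k : R) (x : C) : C :=
  cpow k%:C (x / k%:C - 1) * Gamma (x / k%:C).

Definition kStruve (k : R) (nu c x : C) : C :=
  csum (fun r : nat =>
    (- c) ^+ r
    / (kGamma k (r%:R * k%:C + nu + 3 * k%:C / 2) * Gamma (r%:R + 3 / 2))
    * cpow (x / 2) (2 * r%:R + nu / k%:C + 1)).

Definition MittagLeffler (alpha beta x : C) : C :=
  csum (fun n : nat => x ^+ n / Gamma (alpha * n%:R + beta)).

Definition cintegrable (D : set R) (g : R -> C) : Prop :=
  lebesgue_measure.-integrable D (fun u => (complex.Re (g u))%:E) /\
  lebesgue_measure.-integrable D (fun u => (complex.Im (g u))%:E).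

Definition cintegral (D : set R) (g : R -> C) : C :=
  (\int[lebesgue_measure]_(u in D) complex.Re (g u)) +i*
  (\int[lebesgue_measure]_(u in D) complex.Im (g u)).

(* For complex t the integral runs along the segment from 0 to t,
   parametrized by s = u t, 0 <= u <= 1. *)
Definition RL_integrand (v : C) (f : C -> C) (t : C) (u : R) : C :=
  cpow (t - u%:C * t) (v - 1) * f (u%:C * t) * t.

Definition RL_defined (v : C) (f : C -> C) (t : C) : Prop :=
  cintegrable `[0, 1] (RL_integrand v f t).

Definition RL_integral (v : C) (f : C -> C) (t : C) : C :=
  (Gamma v)^-1 * cintegral `[0, 1] (RL_integrand v f t).

(* The t for which t^v is computed without leaving the principal sheet, so
   that (t^v)^w = t^(v w).  It contains every t > 0, and is C \ {0} when
   v <= 1. *)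
Definition principal_domain (v : R) : set C :=
  [set t | t != 0 /\ - pi < v * carg t <= pi].

Definition kinetic_solution (k d v : R) (a c l N0 : C) (N : C -> C) : Prop :=
  forall t, principal_domain v t ->
    RL_defined v%:C N t /\
    N t - N0 * kStruve k l c ((d `^ v)%:C * cpow t v%:C)
      = - cpow a v%:C * RL_integral v%:C N t.

Definition kinetic_term (k d v : R) (a c l t : C) (r : nat) : C :=
  (- c) ^+ r
  * Gamma (2 * r%:R * v%:C + v%:C * (l / k%:C) + v%:C + 1)
  / (kGamma k (r%:R * k%:C + l + 3 / 2 * k%:C) * Gamma (r%:R + 3 / 2))
  * cpow ((d `^ v)%:C / 2) (2 * r%:R + l / k%:C + 1)
  * cpow t (v%:C * (2 * r%:R + l / k%:C + 1))
  * MittagLeffler v%:C (2 * r%:R * v%:C + l / k%:C * v%:C + v%:C + 1)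
      (- cpow a v%:C * cpow t v%:C).

End ComplexFunctions.

(* Main.v *)
(* With p_r = v (2 r + l / k + 1) and A = a^v, the r-th term of the series is
     K_r t^p_r sum_n Gamma (p_r + 1) / Gamma (v n + p_r + 1) (- A t^v)^n.
   By the Beta integral, the Riemann-Liouville operator of order v maps t^p to
   Gamma (p + 1) / Gamma (p + v + 1) t^(p + v), so that applying - A times this
   operator shifts the inner series by one: what is missing is its term n = 0,
   that is K_r t^p_r, and these sum up to the k-Struve function of d^v t^v.
   Every sum and integral may be exchanged because the quotients of Gamma
   values are products of Beta integrals B(p_0 + 1 + j v, v), which bound them
   uniformly in r and tend to 0 with j.

   The Beta-Gamma formula is derived for Gauss's product, without Euler's
   integral for Gamma: integration by parts relates B(z, v) to B(z + n, v), and
   B(z + n, v) / B(n, v) tends to 1.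

   Uniqueness: on each ray the difference of two solutions satisfies a
   homogeneous Volterra equation with the kernel (s - w)^(v - 1).  Integrating
   against exp (- n s) and using Tonelli bounds its weighted L1 norm by a small
   multiple of itself. *)

Require Import Defs.
From HB Require Import structures.
From mathcomp Require Import all_boot all_order all_algebra.
From mathcomp Require Import complex.
From mathcomp Require Import all_classical all_reals all_analysis.
From mathcomp Require Import measurable_realfun ring lra.

Set Implicit Arguments.
Unset Strict Implicit.
Unset Printing Implicit Defensive.

Import Order.TTheory GRing.Theory Num.Theory.
Import numFieldNormedType.Exports.

Local Open Scope classical_set_scope.
Local Open Scope ring_scope.
Local Open Scope complex_scope.

(** The condition [l_int] says that t^p_0 is integrable at 0: with [P0] the real part of p_0, the
    kernel u^P0 (1 - u)^(v - 1) is integrable on ]0, 1[, and up to summable constants it dominates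
    every term of both sums. Powers are principal, so the power of a product is split only when one
    factor is a positive real. Hence integrals are taken over u in ]0, 1[ with argument u t, and the
    branch condition in [principal_domain] acts at one point only, in rewriting (d^v t^v)^w. It is
    invariant under positive scaling, so it holds along whole rays. Integration is real, so complex
    integrals are bounded through their real and imaginary parts; each such passage costs a factor
    2, the origin of most constants 2 and 4. Uniqueness meets an obstacle when v > 1: integrability
    of (1 - u)^(v - 1) N(u t) does not control N near u = 1. The Volterra argument therefore covers
    half of the segment, and is run on the segment from 0 to 2 t. *)

Local Notation normc := Normc.normc.
Local Notation Re := complex.Re.
Local Notation Im := complex.Im.

(** * Complex exponentials and principal powers *)

(* The prefix [c] avoids a clash with the lemmas of [Num.Theory] on ['Re]. *)
Section ComplexNorm.
Context {R : realType}.
Local Notation C := R[i].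
Implicit Types (z w : C) (x y : R).

Lemma complexP z w : Re z = Re w -> Im z = Im w -> z = w.
Proof. by case: z w => [a b] [c e] /= -> ->. Qed.

Lemma cReD z w : Re (z + w) = Re z + Re w. Proof. by case: z; case: w. Qed.
Lemma cImD z w : Im (z + w) = Im z + Im w. Proof. by case: z; case: w. Qed.
Lemma cReN z : Re (- z) = - Re z. Proof. by case: z. Qed.
Lemma cImN z : Im (- z) = - Im z. Proof. by case: z. Qed.
Lemma cReB z w : Re (z - w) = Re z - Re w. Proof. by rewrite cReD cReN. Qed.
Lemma cImB z w : Im (z - w) = Im z - Im w. Proof. by rewrite cImD cImN. Qed.
Lemma cReM z w : Re (z * w) = Re z * Re w - Im z * Im w.
Proof. by case: z; case: w. Qed.
Lemma cImM z w : Im (z * w) = Re z * Im w + Im z * Re w.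
Proof. by case: z; case: w. Qed.
Lemma cReZ x z : Re (x%:C * z) = x * Re z.
Proof. by rewrite cReM /= mul0r subr0. Qed.
Lemma cImZ x z : Im (x%:C * z) = x * Im z.
Proof. by rewrite cImM /= mul0r addr0. Qed.

Lemma real_complexD x y : (x + y)%:C = x%:C + y%:C :> C.
Proof. exact: rmorphD. Qed.
Lemma real_complexB x y : (x - y)%:C = x%:C - y%:C :> C.
Proof. exact: rmorphB. Qed.
Lemma real_complexM x y : (x * y)%:C = x%:C * y%:C :> C.
Proof. exact: rmorphM. Qed.
Lemma real_complexV x : (x^-1)%:C = (x%:C)^-1 :> C.
Proof. exact: fmorphV. Qed.
Lemma real_complex_nat n : (n%:R)%:C = n%:R :> C.
Proof. exact: rmorph_nat. Qed.
Lemma Re_nat n : Re (n%:R : C) = n%:R.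
Proof. by rewrite -real_complex_nat. Qed.
Lemma Im_nat n : Im (n%:R : C) = 0.
Proof. by rewrite -real_complex_nat. Qed.

Lemma normcE z : normc z = Num.sqrt (Re z ^+ 2 + Im z ^+ 2).
Proof. by case: z. Qed.
Lemma normc_ge0 z : 0 <= normc z.
Proof. by rewrite normcE sqrtr_ge0. Qed.
Lemma normc_eq0 z : (normc z == 0) = (z == 0).
Proof.
by apply/eqP/eqP => [/Normc.eq0_normc //|->]; rewrite Normc.normc0.
Qed.
Lemma normc_gt0 z : (0 < normc z) = (z != 0).
Proof. by rewrite lt_def normc_ge0 andbT normc_eq0. Qed.
Lemma normr_normc z : `|z| = (normc z)%:C.
Proof. by rewrite normcE normc_def. Qed.
Lemma normcX z n : normc (z ^+ n) = normc z ^+ n.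
Proof.
elim: n => [|n ih]; first by rewrite !expr0 Normc.normc1.
by rewrite !exprS Normc.normcM ih.
Qed.
Lemma normc_real x : normc x%:C = `|x|.
Proof. by rewrite normcE /= expr0n addr0 sqrtr_sqr. Qed.
Lemma normc_nat n : normc (n%:R : C) = n%:R.
Proof. by rewrite -real_complex_nat normc_real ger0_norm. Qed.
Lemma ler_Re_normc z : `|Re z| <= normc z.
Proof. by rewrite normcE -sqrtr_sqr ler_wsqrtr // lerDl sqr_ge0. Qed.
Lemma ler_Im_normc z : `|Im z| <= normc z.
Proof. by rewrite normcE -sqrtr_sqr ler_wsqrtr // lerDr sqr_ge0. Qed.
Lemma ler_normc_ReIm z : normc z <= `|Re z| + `|Im z|.
Proof.
rewrite normcE -[leRHS]ger0_norm ?addr_ge0// -sqrtr_sqr ler_wsqrtr//.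
by rewrite sqrrD !real_normK ?num_real// addrAC lerDl mulrn_wge0// mulr_ge0.
Qed.
Lemma ler_normcB z w : normc z - normc w <= normc (z - w).
Proof. by rewrite lerBlDr -{1}(subrK w z) le_normcD. Qed.
Lemma normc_sum I (s : seq I) (P : pred I) (F : I -> C) :
  normc (\sum_(i <- s | P i) F i) <= \sum_(i <- s | P i) normc (F i).
Proof.
elim/big_ind2 : _ => [|a b c e ab ce|//]; first by rewrite Normc.normc0.
by rewrite (le_trans (le_normcD _ _))// lerD.
Qed.
End ComplexNorm.

Section ComplexPower.
Context {R : realType}.
Local Notation C := R[i].
Implicit Types (z w t : C) (x y : R).

Lemma Re_cexp z : Re (cexp z) = expR (Re z) * cos (Im z).
Proof. by rewrite /cexp cReZ. Qed.
Lemma Im_cexp z : Im (cexp z) = expR (Re z) * sin (Im z).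
Proof. by rewrite /cexp cImZ. Qed.

Lemma cexpD z w : cexp (z + w) = cexp z * cexp w.
Proof.
apply: complexP.
  by rewrite [RHS]cReM !Re_cexp !Im_cexp cReD cImD expRD cosD; ring.
by rewrite [RHS]cImM !Re_cexp !Im_cexp cReD cImD expRD sinD; ring.
Qed.

Lemma cexp0 : cexp 0 = 1 :> C.
Proof. by apply: complexP; rewrite ?Re_cexp ?Im_cexp /= ?expR0 ?cos0 ?sin0 mul1r. Qed.

Lemma normc_cexp z : normc (cexp z) = expR (Re z).
Proof.
rewrite normcE Re_cexp Im_cexp !exprMn -mulrDr cos2Dsin2 mulr1 sqrtr_sqr.
by rewrite ger0_norm// expR_ge0.
Qed.

Lemma cexp_neq0 z : cexp z != 0.
Proof. by rewrite -normc_gt0 normc_cexp expR_gt0. Qed.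

Lemma Re_div_normc z : z != 0 -> -1 <= Re z / normc z <= 1.
Proof.
move=> z0; rewrite -ler_norml normrM normfV (ger0_norm (normc_ge0 z)).
by rewrite ler_pdivrMr ?normc_gt0// mul1r ler_Re_normc.
Qed.

(** The cosine of [carg z] is Re z / |z| by construction; its sine is |Im z| / |z| up to sign, and
    the case split in [carg] supplies the sign. *)
Lemma cexp_clog z : z != 0 -> cexp (clog z) = z.
Proof.
move=> z0; have zp : 0 < normc z by rewrite normc_gt0.
have zs := Re_div_normc z0.
have key : 1 - (Re z / normc z) ^+ 2 = (Im z / normc z) ^+ 2.
  rewrite !exprMn exprVn.
  have : normc z ^+ 2 = Re z ^+ 2 + Im z ^+ 2.
    by rewrite normcE sqr_sqrtr// addr_ge0 ?sqr_ge0.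
  move=> e; have n2 : normc z ^+ 2 != 0 by rewrite expf_neq0// gt_eqF.
  by rewrite -[X in X - _](divff n2) -mulrBl e addrC addKr.
apply: complexP; rewrite ?Re_cexp ?Im_cexp /= lnK ?posrE// /carg.
  case: ifP => _; rewrite ?cosN acosK ?in_itv//= mulrC divfK ?gt_eqF//.
case: ifPn => [im0|]; rewrite ?sinN sin_acos// key sqrtr_sqr.
  by rewrite ger0_norm ?divr_ge0 ?normc_ge0// mulrC divfK ?gt_eqF.
rewrite -ltNge => im0; rewrite ltr0_norm; last by rewrite pmulr_llt0 ?invr_gt0.
by rewrite opprK mulrC divfK ?gt_eqF.
Qed.

Lemma clog_cexp z : - pi < Im z <= pi -> clog (cexp z) = z.
Proof.
move=> /andP[z1 z2]; rewrite /clog normc_cexp expRK.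
suff -> : carg (cexp z) = Im z by case: (z).
rewrite /carg normc_cexp Re_cexp Im_cexp (mulrC _ (cos _)).
rewrite mulfK ?gt_eqF ?expR_gt0//.
(* [carg] branches on the sign of the sine, which on ]-pi, pi] is nonnegative exactly at the
   nonnegative angles. *)
rewrite pmulr_rge0 ?expR_gt0//; case: (leP 0 (Im z)) => im0.
  by rewrite sin_ge0_pi ?im0 ?z2// cosK// in_itv/= im0.
have : 0 < sin (- Im z) by apply: sin_gt0_pi; rewrite oppr_gt0 im0 ltrNl.
rewrite sinN oppr_gt0 => /ltW; rewrite leNgt => /negbTE.
have s0 : sin (Im z) < 0.
  by rewrite -oppr_gt0 -sinN; apply: sin_gt0_pi; rewrite oppr_gt0 im0 ltrNl.
by move=> _; rewrite leNgt s0/= -cosN cosK ?opprK// in_itv/=; lra.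
Qed.

Lemma cpowE z w : z != 0 -> cpow z w = cexp (w * clog z).
Proof. by rewrite /cpow => /negbTE ->. Qed.

Lemma cpow_neq0 z w : z != 0 -> cpow z w != 0.
Proof. by move=> z0; rewrite cpowE// cexp_neq0. Qed.

Lemma cpowD z w t : z != 0 -> cpow z (w + t) = cpow z w * cpow z t.
Proof. by move=> z0; rewrite !cpowE// mulrDl cexpD. Qed.

Lemma cpowr1 z : z != 0 -> cpow z 1 = z.
Proof. by move=> z0; rewrite cpowE// mul1r cexp_clog. Qed.

Lemma cpowr0 z : cpow z 0 = 1.
Proof. by rewrite /cpow eqxx mul0r cexp0; case: ifP. Qed.

Lemma cpowM_nat z w n : z != 0 -> cpow z (w * n%:R) = cpow z w ^+ n.
Proof.
move=> z0; elim: n => [|n ih]; first by rewrite mulr0 cpowr0 expr0.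
by rewrite -natr1 mulrDr mulr1 cpowD// ih exprSr.
Qed.

Lemma cpow_nat z n : z != 0 -> cpow z n%:R = z ^+ n.
Proof. by move=> z0; rewrite -[n%:R]mul1r cpowM_nat// cpowr1. Qed.

Lemma real_complex_eq0 x : (x%:C == 0 :> C) = (x == 0).
Proof. by rewrite -normc_eq0 normc_real normr_eq0. Qed.

Lemma clog_real x : 0 < x -> clog x%:C = (ln x)%:C.
Proof.
move=> x0; rewrite /clog /carg normc_real gtr0_norm//= lexx divff ?gt_eqF//.
by rewrite acos1.
Qed.

(** A positive factor does not move the argument, so no branch is crossed. Every later splitting of
    [cpow] on a product rests on this. *)
Lemma clogM_real x t : 0 < x -> t != 0 -> clog (x%:C * t) = (ln x)%:C + clog t.
Proof.
move=> x0 t0; apply: complexP => /=.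
  rewrite Normc.normcM normc_real (gtr0_norm x0) lnM ?posrE// normc_gt0//.
rewrite add0r /carg cReZ cImZ Normc.normcM normc_real (gtr0_norm x0).
by rewrite -mulf_div divff ?gt_eqF// mul1r pmulr_rge0.
Qed.

Lemma cpowM_real x t w : 0 < x -> t != 0 ->
  cpow (x%:C * t) w = cpow x%:C w * cpow t w.
Proof.
move=> x0 t0; have xC0 : x%:C != 0 :> C by rewrite real_complex_eq0 gt_eqF.
by rewrite !cpowE ?mulf_neq0// clogM_real// clog_real// mulrDr cexpD.
Qed.

Lemma carg_scale x t : 0 < x -> t != 0 -> carg (x%:C * t) = carg t.
Proof.
move=> x0 t0; have := congr1 (@complex.Im R) (clogM_real x0 t0).
by rewrite cImD /= add0r.
Qed.

Lemma Re_cpow_real x w : 0 < x ->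
  Re (cpow x%:C w) = x `^ Re w * cos (Im w * ln x).
Proof.
move=> x0; rewrite cpowE ?real_complex_eq0 ?gt_eqF// clog_real//.
by rewrite Re_cexp cReM cImM /= !mulr0 subr0 add0r /powR gt_eqF.
Qed.

Lemma Im_cpow_real x w : 0 < x ->
  Im (cpow x%:C w) = x `^ Re w * sin (Im w * ln x).
Proof.
move=> x0; rewrite cpowE ?real_complex_eq0 ?gt_eqF// clog_real//.
by rewrite Im_cexp cReM cImM /= !mulr0 subr0 add0r /powR gt_eqF.
Qed.

Lemma cpow_real x y : 0 < x -> cpow x%:C y%:C = (x `^ y)%:C.
Proof.
move=> x0; apply: complexP; rewrite ?Re_cpow_real ?Im_cpow_real//= mul0r.
  by rewrite cos0 mulr1.
by rewrite sin0 mulr0.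
Qed.

Lemma normc_cpow_real x w : 0 < x -> normc (cpow x%:C w) = x `^ Re w.
Proof.
move=> x0; rewrite cpowE ?real_complex_eq0 ?gt_eqF// clog_real// normc_cexp.
by rewrite cReM /= mulr0 subr0 /powR gt_eqF.
Qed.

(** [principal_domain v t] puts the imaginary part of v log t into ]-pi, pi], where [clog] inverts
    [cexp]. *)
Lemma cpow_cpow t (v : R) w : principal_domain v t ->
  cpow (cpow t v%:C) w = cpow t (v%:C * w).
Proof.
move=> [t0 /= hv]; rewrite cpowE ?cpow_neq0// (cpowE _ t0).
by rewrite clog_cexp ?cImZ// (cpowE _ t0) mulrA (mulrC w).
Qed.

Lemma principal_domain_scale x t (v : R) : 0 < x -> principal_domain v t ->
  principal_domain v (x%:C * t).
Proof.
move=> x0 [t0 /= hv]; split; last by rewrite /= carg_scale.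
by rewrite mulf_neq0// real_complex_eq0 gt_eqF.
Qed.
End ComplexPower.

(** * Limits and series of complex numbers *)

Section ComplexLimits.
Context {R : realType}.
Local Notation C := R[i].
Implicit Types (u w : nat -> C) (b : nat -> R) (x y z : C).

Lemma eq_seq_cvg (T : topologicalType) (f g : nat -> T) (l : T) :
  f =1 g -> f @ \oo --> l -> g @ \oo --> l.
Proof. by move=> /funext ->. Qed.

Lemma ccvgP u z :
  (u : nat -> C^o) @ \oo --> (z : C^o) <->
  ((fun n => Re (u n)) @ \oo --> Re z) /\ ((fun n => Im (u n)) @ \oo --> Im z).
Proof.
split=> [/cvgrPdist_lt uz|[/cvgrPdist_lt uR /cvgrPdist_lt uI]].
  split; apply/cvgrPdist_lt => e e0; near=> n.
    rewrite -cReB (le_lt_trans (ler_Re_normc _))// -ltcR -normr_normc.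
    by near: n; apply: uz; rewrite ltcR.
  rewrite -cImB (le_lt_trans (ler_Im_normc _))// -ltcR -normr_normc.
  by near: n; apply: uz; rewrite ltcR.
(* A positive [e] for the order of [C] is real, so the epsilon can be taken in [R]. *)
apply/cvgrPdist_lt => e; rewrite ltcE /= => /andP[/eqP im0 e0].
have -> : e = (Re e)%:C by apply: complexP.
near=> n; rewrite normr_normc ltcR (le_lt_trans (ler_normc_ReIm _))//.
rewrite cReB cImB [ltRHS]splitr ltrD//; near: n; [apply: uR|apply: uI];
  exact: divr_gt0.
Unshelve. all: by end_near. Qed.

Lemma ccvg_lim u z : (u : nat -> C^o) @ \oo --> (z : C^o) ->
  limn (u : nat -> C^o) = z.
Proof. by move=> uz; apply: cvg_lim uz; exact: norm_hausdorff. Qed.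

Lemma ccvg_unique u (z w : C) : (u : nat -> C^o) @ \oo --> (z : C^o) ->
  (u : nat -> C^o) @ \oo --> (w : C^o) -> z = w.
Proof. by move=> /ccvg_lim <- /ccvg_lim <-. Qed.

Lemma ccvg_norm0 u z : (fun n => normc (u n - z)) @ \oo --> (0 : R) ->
  (u : nat -> C^o) @ \oo --> (z : C^o).
Proof.
move=> /cvgrPdist_lt h; apply/cvgrPdist_lt => e.
rewrite ltcE /= => /andP[/eqP im0 e0].
have -> : e = (Re e)%:C by apply: complexP.
near=> n; rewrite normr_normc ltcR -normcN opprB.
suff : `|0 - normc (u n - z)| < Re e.
  by rewrite sub0r normrN ger0_norm// normc_ge0.
by near: n; apply: h.
Unshelve. all: by end_near. Qed.

Lemma cvg_normc u z : (u : nat -> C^o) @ \oo --> (z : C^o) ->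
  (fun n => normc (u n)) @ \oo --> normc z.
Proof.
move=> /cvgrPdist_lt uz; apply/cvgrPdist_lt => e e0; near=> n.
rewrite (@le_lt_trans _ _ (normc (z - u n)))//; last first.
  by rewrite -ltcR -normr_normc; near: n; apply: uz; rewrite ltcR.
rewrite ler_norml lerNl opprB ler_normcB andbT.
by rewrite -(normcN (z - u n)) opprB ler_normcB.
Unshelve. all: by end_near. Qed.

Lemma Re_series u n : Re (series (u : nat -> C^o) n) = series (fun k => Re (u k)) n.
Proof. by rewrite /series /=; elim/big_rec2: _ => // i a c _ <-; rewrite cReD. Qed.
Lemma Im_series u n : Im (series (u : nat -> C^o) n) = series (fun k => Im (u k)) n.
Proof. by rewrite /series /=; elim/big_rec2: _ => // i a c _ <-; rewrite cImD. Qed.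

Lemma csum_cvg u : csummable u ->
  series (u : nat -> C^o) @ \oo --> (csum u : C^o).
Proof. by []. Qed.

Lemma cvg_csummable u z : series (u : nat -> C^o) @ \oo --> (z : C^o) ->
  csummable u.
Proof. by move=> h; apply/cvg_ex; exists (z : C^o). Qed.

Lemma csum_unique u z : series (u : nat -> C^o) @ \oo --> (z : C^o) ->
  csum u = z.
Proof. exact: ccvg_lim. Qed.

Lemma eq_csum u w : u =1 w -> csum u = csum w.
Proof. by move=> /funext ->. Qed.

Lemma csummable_dom u b : (forall n, normc (u n) <= b n) -> cvgn (series b) ->
  csummable u.
Proof.
move=> ub cb.
have [lR hR] : exists l : R, series (fun k => Re (u k)) @ \oo --> l.
  apply/cvg_ex; apply: normed_cvg; rewrite /normed_series_of.
  apply: (series_le_cvg _ _ _ cb) => n; rewrite ?normr_ge0//=.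
  - exact: (le_trans (normc_ge0 _) (ub n)).
  - exact: (le_trans (ler_Re_normc _) (ub n)).
have [lI hI] : exists l : R, series (fun k => Im (u k)) @ \oo --> l.
  apply/cvg_ex; apply: normed_cvg; rewrite /normed_series_of.
  apply: (series_le_cvg _ _ _ cb) => n; rewrite ?normr_ge0//=.
  - exact: (le_trans (normc_ge0 _) (ub n)).
  - exact: (le_trans (ler_Im_normc _) (ub n)).
apply/cvg_ex; exists (lR +i* lI : C); apply/ccvgP; split => /=.
  by under eq_cvg do rewrite Re_series.
by under eq_cvg do rewrite Im_series.
Qed.

Lemma normc_csum u b : (forall n, normc (u n) <= b n) -> cvgn (series b) ->
  normc (csum u) <= limn (series b).
Proof.
move=> ub cb; have /cvg_normc h := csum_cvg (csummable_dom ub cb).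
rewrite -(cvg_lim _ h)//; apply: ler_lim => //; first by apply/cvg_ex; eexists; exact: h.
near=> n; rewrite /series /= (le_trans (normc_sum _ _ _))// ler_sum//.
Unshelve. all: by end_near. Qed.

Lemma ccvgM u w (x y : C) : (u : nat -> C^o) @ \oo --> (x : C^o) ->
  (w : nat -> C^o) @ \oo --> (y : C^o) ->
  ((fun n => u n * w n) : nat -> C^o) @ \oo --> (x * y : C^o).
Proof. by move=> ux wy; exact: (@cvgM C nat \oo _ u w x y ux wy). Qed.

Lemma ccvgD u w (x y : C) : (u : nat -> C^o) @ \oo --> (x : C^o) ->
  (w : nat -> C^o) @ \oo --> (y : C^o) ->
  ((fun n => u n + w n) : nat -> C^o) @ \oo --> (x + y : C^o).
Proof. by move=> ux wy; exact: (@cvgD _ C^o nat \oo _ u w x y ux wy). Qed.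

Lemma ccvgB u w (x y : C) : (u : nat -> C^o) @ \oo --> (x : C^o) ->
  (w : nat -> C^o) @ \oo --> (y : C^o) ->
  ((fun n => u n - w n) : nat -> C^o) @ \oo --> (x - y : C^o).
Proof. by move=> ux wy; exact: (@cvgB _ C^o nat \oo _ u w x y ux wy). Qed.

Lemma ccvg_cst (x : C) : ((fun=> x) : nat -> C^o) @ \oo --> (x : C^o).
Proof. exact: cvg_cst. Qed.

Lemma csummableZ x u : csummable u ->
  series ((fun n => x * u n) : nat -> C^o) @ \oo --> (x * csum u : C^o).
Proof.
move=> cu; apply: eq_seq_cvg (ccvgM (@ccvg_cst x) (csum_cvg cu)) => n.
by rewrite /series /= mulr_sumr.
Qed.

Lemma csumZ x u : csummable u -> csum (fun n => x * u n) = x * csum u.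
Proof. by move=> /csummableZ/csum_unique. Qed.

Lemma csumB u w : csummable u -> csummable w ->
  csum (fun n => u n - w n) = csum u - csum w.
Proof.
move=> cu cw; apply: csum_unique.
apply: eq_seq_cvg (ccvgB (csum_cvg cu) (csum_cvg cw)) => n.
by rewrite /series /= -sumrB.
Qed.

Lemma csum_recl u : csummable u ->
  csum u = u 0%N + csum (fun n => u n.+1).
Proof.
move=> cu; suff -> : csum (fun n => u n.+1) = csum u - u 0%N by rewrite addrC subrK.
apply: csum_unique.
have h : (fun n => series (u : nat -> C^o) n.+1) @ \oo --> (csum u : C^o).
  by rewrite (cvg_shiftS (series (u : nat -> C^o))).
apply: eq_seq_cvg (ccvgB h (@ccvg_cst (u 0%N))) => n /=.
by rewrite /series /= big_nat_recl//= addrC addKr.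
Qed.

Lemma is_cvg_series_addn b N :
  cvgn (series (fun n => b (n + N)%N)) -> cvgn (series b).
Proof.
move=> cb; apply/cvg_ex; exists (series b N + limn (series (fun n => b (n + N)%N))).
rewrite -(cvg_shiftn N).
apply: eq_seq_cvg (cvgD (cvg_cst (series b N)) (cb : _ --> limn _)) => n /=.
rewrite /series /= [RHS](@big_cat_nat _ _ _ N)//= ?leq_addl//; congr (_ + _).
by rewrite -{2}[N]add0n big_addn addnK.
Qed.

(** D'Alembert's test, written without quotients so that vanishing terms are harmless: once [r n] is
    at most 1/2, the terms at least halve at each step. *)
Lemma ratio_cvg_series b (r : nat -> R) : (forall n, 0 <= b n) ->
  (\forall n \near \oo, b n.+1 <= r n * b n) -> r @ \oo --> (0 : R) ->
  cvgn (series b).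
Proof.
move=> b0 [N1 _ hb] /cvgrPdist_le /(_ (2^-1) ltac:(by rewrite invr_gt0)) [N2 _ hr].
pose N := maxn N1 N2.
have hN n : (N <= n)%N -> b n.+1 <= 2^-1 * b n.
  rewrite geq_max => /andP[n1 n2]; rewrite (le_trans (hb _ n1))//.
  rewrite ler_wpM2r//; have := hr _ n2.
  by rewrite sub0r normrN; apply: le_trans; exact: ler_norm.
have hg n : b (n + N)%N <= geometric (b N) 2^-1 n.
  elim: n => [|n ih]; first by rewrite /= expr0 mulr1.
  rewrite addSn (le_trans (hN _ (leq_addl _ _)))// /= exprS mulrCA.
  by rewrite ler_pM2l// invr_gt0.
apply: (@is_cvg_series_addn _ N); apply: (@series_le_cvg _ _ (geometric (b N) 2^-1)) => //.
- by move=> n; rewrite mulr_ge0// exprn_ge0// invr_ge0.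
- by apply: is_cvg_geometric_series; rewrite ger0_norm ?invr_ge0// invf_lt1//; lra.
Qed.
End ComplexLimits.
Arguments ccvg_cst {R} x _ _.

(** * Convergence of Gauss's product *)

Section ExponentialBounds.
Context {R : realType}.
Local Notation C := R[i].
Implicit Types (z : C) (x : R).

Lemma ler_norm_derive01 (f df : R -> R) M :
  (forall x, is_derive x 1 f (df x)) ->
  (forall x, 0 <= x <= 1 -> `|df x| <= M) -> `|f 1 - f 0| <= M.
Proof.
move=> fdf dfM; have cf : {within `[0, 1], continuous f}.
  apply: continuous_subspaceT => x; apply: differentiable_continuous.
  by apply/derivable1_diffP; have [] := fdf x.
have [c + ->] := MVT ltr01 (fun x _ => fdf x) cf.
by rewrite subr0 mulr1 in_itv/= => /andP[c0 c1]; apply: dfM; rewrite !ltW.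
Qed.

Lemma is_derive_Re_cexp z x :
  is_derive x 1 (fun s => Re (cexp (s%:C * z))) (Re (z * cexp (x%:C * z))).
Proof.
under [X in is_derive _ _ X _]funext => s do rewrite Re_cexp cReZ cImZ.
apply: is_derive_eq; rewrite /GRing.scale /= cReM Re_cexp Im_cexp cReZ cImZ; ring.
Qed.

Lemma is_derive_Im_cexp z x :
  is_derive x 1 (fun s => Im (cexp (s%:C * z))) (Im (z * cexp (x%:C * z))).
Proof.
under [X in is_derive _ _ X _]funext => s do rewrite Im_cexp cReZ cImZ.
apply: is_derive_eq; rewrite /GRing.scale /= cImM Re_cexp Im_cexp cReZ cImZ; ring.
Qed.

(** Mean value bound along s -> exp (s z) on [0, 1], once for each of the two parts. Keeping [b]
    apart from |z| gives 2 |z| without an exponential when Re z <= 0. *)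
Lemma cexp_sub1_le z (b : R) : Re z <= b -> 0 <= b ->
  normc (cexp z - 1) <= 2 * (normc z * expR b).
Proof.
move=> zb b0.
have bound x : 0 <= x <= 1 -> normc (z * cexp (x%:C * z)) <= normc z * expR b.
  move=> /andP[x0 x1]; rewrite Normc.normcM ler_wpM2l ?normc_ge0//.
  rewrite normc_cexp cReZ ler_expR; have [zn|zp] := leP (Re z) 0.
    by rewrite (le_trans _ b0)// mulr_ge0_le0.
  by rewrite (le_trans _ zb)// ler_piMl// ltW.
have hR := ler_norm_derive01 (is_derive_Re_cexp z)
  (fun x hx => le_trans (ler_Re_normc _) (bound x hx)).
have hI := ler_norm_derive01 (is_derive_Im_cexp z)
  (fun x hx => le_trans (ler_Im_normc _) (bound x hx)).
rewrite (le_trans (ler_normc_ReIm _))// mulr_natl mulr2n.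
by move: hR hI; rewrite mul1r mul0r cexp0 -cReB -cImB; exact: lerD.
Qed.

(** The same argument one order further: exp (s z) - s z has derivative z (exp (s z) - 1), to which
    the first-order bound applies. *)
Lemma cexp_sub1D_le z :
  normc (cexp z - 1 - z) <= 4 * (normc z ^+ 2 * expR (normc z)).
Proof.
have bound x : 0 <= x <= 1 ->
    normc (z * (cexp (x%:C * z) - 1)) <= 2 * (normc z ^+ 2 * expR (normc z)).
  move=> /andP[x0 x1]; rewrite Normc.normcM.
  have h : normc (x%:C * z) <= normc z.
    by rewrite Normc.normcM normc_real ger0_norm// ler_piMl// normc_ge0.
  have := @cexp_sub1_le (x%:C * z) (normc z)
    (le_trans (le_trans (ler_norm _) (ler_Re_normc _)) h) (normc_ge0 _).
  move=> /(ler_wpM2l (normc_ge0 z)) /le_trans; apply.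
  rewrite mulrCA ler_pM2l// expr2 -mulrA ler_wpM2l ?normc_ge0//.
  by rewrite ler_wpM2r// expR_ge0.
have dR x : is_derive x 1 (fun s => Re (cexp (s%:C * z)) - s * Re z)
    (Re (z * (cexp (x%:C * z) - 1))).
  have h := is_derive_Re_cexp z x.
  apply: is_derive_eq; rewrite mulrBr mulr1 cReB /GRing.scale /=; ring.
have dI x : is_derive x 1 (fun s => Im (cexp (s%:C * z)) - s * Im z)
    (Im (z * (cexp (x%:C * z) - 1))).
  have h := is_derive_Im_cexp z x.
  apply: is_derive_eq; rewrite mulrBr mulr1 cImB /GRing.scale /=; ring.
have hR := ler_norm_derive01 dR
  (fun x hx => le_trans (ler_Re_normc _) (bound x hx)).
have hI := ler_norm_derive01 dI
  (fun x hx => le_trans (ler_Im_normc _) (bound x hx)).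
rewrite (le_trans (ler_normc_ReIm _))//.
move: hR hI; rewrite !mul1r !mul0r cexp0 !subr0 => hR hI.
have -> : Re (cexp z - 1 - z) = Re (cexp z) - Re z - Re (1 : C).
  by rewrite !cReB addrAC.
have -> : Im (cexp z - 1 - z) = Im (cexp z) - Im z - Im (1 : C).
  by rewrite !cImB addrAC.
rewrite [Im (1 : C)]/= subr0.
apply: (le_trans (lerD hR hI)); rewrite -mulrDl -natrD.
by [].
Qed.

End ExponentialBounds.

(** * Gauss's sequence as an infinite product *)

Section GammaLimit.
Context {R : realType}.
Local Notation C := R[i].
Implicit Types (z : C) (x : R).

Definition gauss z (n : nat) : C :=
  n`!%:R * cpow n%:R z / \prod_(i < n.+1) (z + i%:R).

(** Criterion for infinite products, stated on the partial products [g]: summable relative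
    increments bound |g| by |g 0| exp (sum b), and then the increments themselves are summable. It
    serves both [gauss] and its inverse. *)
Lemma ccvg_product (g : nat -> C) (b : nat -> R) :
  (forall n, normc (g n.+1 - g n) <= b n * normc (g n)) ->
  (forall n, 0 <= b n) -> cvgn (series b) -> cvgn (g : nat -> C^o).
Proof.
move=> gb b0 cb.
have [M Mge0 bM] : exists2 M, 0 <= M & forall n, normc (g n) <= M.
  exists (normc (g 0%N) * expR (limn (series b))).
    by rewrite mulr_ge0 ?normc_ge0 ?expR_ge0.
  have ndb : nondecreasing_seq (series b) by exact: nondecreasing_series.
  move=> n; apply: (@le_trans _ _ (normc (g 0%N) * expR (series b n))).
    elim: n => [|n ih]; first by rewrite /series /= big_geq// expR0 mulr1.
    rewrite seriesSr expRD mulrA.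
    apply: (@le_trans _ _ (normc (g n) * (1 + b n))).
      rewrite -{1}(subrK (g n) (g n.+1)) (le_trans (le_normcD _ _))//.
      by rewrite mulrDr mulr1 addrC lerD2l mulrC.
    by rewrite ler_pM// ?normc_ge0 ?expR_ge1Dx// addr_ge0.
  rewrite ler_wpM2l ?normc_ge0// ler_expR.
  exact: nondecreasing_cvgn_le.
have : csummable (fun n => g n.+1 - g n).
  apply: (@csummable_dom _ _ (fun n => M * b n)).
    by move=> n; rewrite (le_trans (gb n))// mulrC ler_wpM2r.
  have -> : series (fun n => M * b n) = (fun n => M * series b n).
    by apply/funext => n; rewrite /series /= mulr_sumr.
  exact: is_cvgMl_tmp.
move=> /csum_cvg h; apply/cvg_ex.
exists (csum (fun n => g n.+1 - g n) + g 0%N : C^o).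
apply: eq_seq_cvg (ccvgD h (ccvg_cst (g 0%N))) => n /=.
by rewrite /series /= telescope_sumr// subrK.
Qed.

(** Telescoping majorant: with m = n + 1, 1/m^2 <= 2 (1/m - 1/(m + 1)) because m + 1 <= 2 m. *)
Lemma is_cvg_series_inv_sqr (K : R) : 0 <= K ->
  cvgn (series (fun n => K / n.+1%:R ^+ 2)).
Proof.
move=> K0; pose t (n : nat) : R := - (2 * K / n.+1%:R).
apply: (@series_le_cvg _ _ (telescope t)).
- by move=> n; rewrite divr_ge0// exprn_ge0.
- move=> n; rewrite /telescope /t /= opprK addrC subr_ge0 ler_wpM2l ?mulr_ge0//.
  by rewrite lef_pV2 ?posrE// ler_nat.
- move=> n; rewrite /telescope /t /= opprK addrC -mulrBr.
  set m : R := n.+1%:R.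
  have m1 : 1 <= m by rewrite ler1n.
  have m0 : 0 < m by rewrite ltr0n.
  have -> : n.+2%:R = m + 1 by rewrite /m natr1.
  have -> : m^-1 - (m + 1)^-1 = (m * (m + 1))^-1.
    by field; rewrite !gt_eqF//; lra.
  rewrite [2 * K]mulrC -mulrA ler_wpM2l// -[leLHS]mul1r ler_pdivrMr ?exprn_gt0//.
  rewrite mulrAC ler_pdivlMr; last by rewrite mulr_gt0//; lra.
  by nra.
have -> : series (telescope t) = (fun n => t n - t 0%N).
  by apply/funext => n; rewrite telescopeK.
apply: is_cvgB; last exact: is_cvg_cst.
apply: is_cvgN; apply: is_cvgMl_tmp.
by apply/cvg_ex; exists 0; exact: cvg_harmonic.
Qed.

Section GaussRatio.
Variable z : C.
Hypothesis z_gt0 : 0 < Re z.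

Lemma addz_nat_neq0 n : z + n%:R != 0.
Proof.
apply/eqP => /(congr1 (@complex.Re R)); rewrite cReD Re_nat /= => /eqP.
by rewrite gt_eqF// ltr_wpDr.
Qed.

Lemma gauss_prod_neq0 n : \prod_(i < n) (z + i%:R) != 0.
Proof. by apply/prodf_neq0 => i _; exact: addz_nat_neq0. Qed.

(** The index starts at 1: [gauss z 0] contains [cpow 0 z], which is 0, and so cannot start a
    product. *)
Lemma gauss_neq0 n : gauss z n.+1 != 0.
Proof.
rewrite /gauss mulf_neq0 ?invr_eq0 ?gauss_prod_neq0// mulf_neq0//.
by rewrite cpow_neq0// pnatr_eq0.
Qed.

Let h (n : nat) : R := ln (n.+2%:R / n.+1%:R).

Lemma cpow_natS n : cpow n.+2%:R z = cpow (n.+1%:R : C) z * cexp ((h n)%:C * z).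
Proof.
rewrite -!real_complex_nat !cpowE ?real_complex_eq0 ?pnatr_eq0// !clog_real//.
by rewrite -cexpD mulrC [z * _]mulrC -mulrDl -real_complexD /h ln_div ?posrE// addrC subrK.
Qed.

Lemma gaussS n :
  gauss z n.+2 = gauss z n.+1 * (n.+2%:R / (z + n.+2%:R) * cexp ((h n)%:C * z)).
Proof.
rewrite /gauss factS natrM big_ord_recr /= cpow_natS.
by rewrite invfM; ring.
Qed.

(** One summand for each error in [gauss_defect]: the quadratic remainder of the exponential, and
    |z| times the gap between [h n] and 1/(n + 2). *)
Let K := 4 * (normc z ^+ 2 * expR (normc z)) + normc z.

(** The relative increment of [gauss] is (n + 2)/(z + n + 2) times this quantity. It is of second
    order because 1/(m + 1) <= h n <= 1/m for m = n + 1, so that h z and z/(n + 2) agree to first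
    order. *)
Lemma gauss_defect n :
  normc (cexp ((h n)%:C * z) - 1 - z / n.+2%:R) <= K / n.+1%:R ^+ 2.
Proof.
set m : R := n.+1%:R.
have m1 : 1 <= m by rewrite ler1n.
have m0 : 0 < m by rewrite ltr0n.
have mS : n.+2%:R = m + 1 by rewrite /m natr1.
have h0 : 0 <= h n by rewrite /h ln_ge0// mS ler_pdivlMr//; lra.
have hu : h n <= m^-1.
  have -> : h n = ln (1 + m^-1) by rewrite /h mS mulrDl divff ?gt_eqF// mul1r.
  by apply: le_ln1Dx; rewrite (lt_le_trans (ltrN10 _))// invr_ge0 ltW.
have hl : (m + 1)^-1 <= h n.
  have -> : h n = - ln (1 - (m + 1)^-1).
    rewrite /h -lnV; last by rewrite posrE subr_gt0 invf_lt1//; lra.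
    by rewrite mS; congr ln; field; rewrite !gt_eqF//; lra.
  rewrite lerNr; apply: le_ln1Dx; rewrite ltrN2 invf_lt1//; lra.
have -> : cexp ((h n)%:C * z) - 1 - z / n.+2%:R =
    (cexp ((h n)%:C * z) - 1 - (h n)%:C * z) + (h n - (m + 1)^-1)%:C * z.
  rewrite -(real_complex_nat n.+2) mS -real_complexV mulrC.
  by rewrite real_complexB; ring.
rewrite (le_trans (le_normcD _ _))// /K mulrDl lerD//.
  rewrite (le_trans (cexp_sub1D_le _))// -[leRHS]mulrA ler_pM2l//.
  have hz : normc ((h n)%:C * z) <= normc z / m.
    rewrite Normc.normcM normc_real ger0_norm// mulrC.
    by rewrite ler_wpM2l ?normc_ge0.
  rewrite [leRHS](_ : _ = (normc z / m) ^+ 2 * expR (normc z)); last first.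
    by rewrite expr_div_n; ring.
  apply: ler_pM; [exact: sqr_ge0|exact: expR_ge0| |].
  - by rewrite ler_sqr ?nnegrE ?normc_ge0// divr_ge0 ?normc_ge0// ltW.
  - by rewrite ler_expR (le_trans hz)// ler_pdivrMr// ler_peMr ?normc_ge0.
rewrite Normc.normcM normc_real ger0_norm ?subr_ge0// mulrC.
rewrite ler_wpM2l ?normc_ge0//.
apply: (@le_trans _ _ (m^-1 - (m + 1)^-1)); first by rewrite lerB.
have -> : m^-1 - (m + 1)^-1 = (m * (m + 1))^-1.
  by field; rewrite !gt_eqF//; lra.
by rewrite lef_pV2 ?posrE ?mulr_gt0 ?exprn_gt0//; nra.
Qed.

Lemma K_ge0 : 0 <= K.
Proof. by rewrite addr_ge0 ?mulr_ge0 ?exprn_ge0 ?normc_ge0// expR_ge0. Qed.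

Lemma normc_nat_ratio n : normc (n.+2%:R / (z + n.+2%:R)) <= 1.
Proof.
rewrite Normc.normcM Normc.normcV normc_nat ler_pdivrMr ?normc_gt0 ?addz_nat_neq0//.
rewrite mul1r (le_trans _ (ler_Re_normc _))// cReD Re_nat.
by rewrite (le_trans _ (ler_norm _))// lerDr ltW.
Qed.

Lemma is_cvg_gauss : cvgn (gauss z : nat -> C^o).
Proof.
have : cvgn ((fun n => gauss z n.+1) : nat -> C^o).
  apply: (@ccvg_product _ (fun n => K / n.+1%:R ^+ 2)).
  - move=> n; rewrite gaussS -{2}[gauss z n.+1]mulr1 -mulrBr Normc.normcM mulrC.
    rewrite ler_wpM2r ?normc_ge0// (le_trans _ (gauss_defect n))//.
    rewrite [X in normc X](_ : _ = n.+2%:R / (z + n.+2%:R) *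
      (cexp ((h n)%:C * z) - 1 - z / n.+2%:R)); last first.
      have := addz_nat_neq0 n.+2; have : n.+2%:R != 0 :> C by rewrite pnatr_eq0.
      by move: (n.+2%:R : C) => m m0 d0; field; rewrite ?d0 ?m0.
    by rewrite Normc.normcM ler_piMl ?normc_ge0// normc_nat_ratio.
  - by move=> n; rewrite divr_ge0 ?K_ge0// exprn_ge0.
  - exact: is_cvg_series_inv_sqr K_ge0.
move=> /cvg_ex[l hl]; apply/cvg_ex; exists l.
by rewrite -(cvg_shiftS (gauss z : nat -> C^o)).
Qed.

Lemma cvg_gauss : (gauss z : nat -> C^o) @ \oo --> (Gamma z : C^o).
Proof. exact: is_cvg_gauss. Qed.

(** The inverses of [gauss] satisfy the same product criterion, so they converge too; the product of
    the two limits is 1. *)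
Lemma Gamma_neq0 : Gamma z != 0.
Proof.
have [l hl] : exists l : C^o, ((fun n => (gauss z n.+1)^-1) : nat -> C^o) @ \oo --> l.
  apply/cvg_ex; apply: (@ccvg_product _ (fun n => K / n.+1%:R ^+ 2)).
  - move=> n; set e := cexp ((h n)%:C * z).
    have e0 : e != 0 by exact: cexp_neq0.
    (* The relative increment of the inverse is the same defect divided by [e], up to sign; |e| is
       at least 1 because Re z and h n are positive. *)
    have -> : (gauss z n.+2)^-1 - (gauss z n.+1)^-1 =
        - (e^-1 * (e - 1 - z / n.+2%:R)) * (gauss z n.+1)^-1.
      rewrite gaussS -/e; move: (gauss_neq0 n) (addz_nat_neq0 n.+2) e0.
      have : n.+2%:R != 0 :> C by rewrite pnatr_eq0.
      move: (n.+2%:R : C) (gauss z n.+1) e => m g e m0 g0 d0 e0.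
      by field; rewrite ?d0 ?e0 ?m0 ?g0.
    rewrite Normc.normcM ler_wpM2r ?normc_ge0// normcN Normc.normcM.
    rewrite (le_trans _ (gauss_defect n))// ler_piMl ?normc_ge0//.
    rewrite Normc.normcV normc_cexp cReZ invf_le1 ?expR_gt0//.
    rewrite -expR0 ler_expR mulr_ge0 ?ltW// /h ln_gt0//.
    by rewrite ltr_pdivlMr// mul1r ltr_nat.
  - by move=> n; rewrite divr_ge0 ?K_ge0// exprn_ge0.
  - exact: is_cvg_series_inv_sqr K_ge0.
have h1 : ((fun n => gauss z n.+1) : nat -> C^o) @ \oo --> (Gamma z : C^o).
  by rewrite (cvg_shiftS (gauss z : nat -> C^o)); exact: cvg_gauss.
have h2 : ((fun=> 1) : nat -> C^o) @ \oo --> (Gamma z * l : C^o).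
  by apply: eq_seq_cvg (ccvgM h1 hl) => n; rewrite divff// gauss_neq0.
apply: contra_eq_neq (ccvg_unique h2 (ccvg_cst 1)) => ->.
by rewrite mul0r eq_sym oner_eq0.
Qed.

End GaussRatio.
End GammaLimit.

(** * The fundamental theorem of calculus on an open interval *)

Section ImproperFTC.
Context {R : realType}.
Local Notation mu := (@lebesgue_measure R).
Implicit Types (f F : R -> R).

(** The shift by 3 makes a n <= 1/3, so that every [I n] is nondegenerate. *)
Let a (n : nat) : R := (n.+3%:R)^-1.
Let I n : set R := `[a n, 1 - a n].

Let a_gt0 n : 0 < a n. Proof. by rewrite /a invr_gt0. Qed.
Let a_lt n : a n < 1 - a n.
Proof.
have : a n <= 3^-1 by rewrite /a lef_pV2 ?posrE ?ler_nat.
by move=> h; lra.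
Qed.

Let a_le m n : (m <= n)%N -> a n <= a m.
Proof. by move=> mn; rewrite /a lef_pV2 ?posrE// ler_nat !ltnS. Qed.

Let I_nd : nondecreasing_seq I.
Proof.
move=> m n mn; apply/subsetPset => x; rewrite /I /= !in_itv/= => /andP[h1 h2].
by have := a_le mn => h; apply/andP; split; lra.
Qed.

Let I_near x : 0 < x < 1 -> \forall n \near \oo, I n x.
Proof.
move=> /andP[x0 x1]; pose e := Num.min x (1 - x).
have e0 : 0 < e by rewrite lt_min x0 subr_gt0.
have /cvgrPdist_lt/(_ _ e0) h := @cvg_harmonic R.
near=> n; have : n.+1%:R^-1 < e.
  have : `|0 - (n.+1%:R : R)^-1| < e by near: n; apply: h.
  by rewrite sub0r normrN ger0_norm// invr_ge0.
rewrite lt_min => /andP[h1 h2].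
have h3 : a n <= n.+1%:R^-1.
  by rewrite /a lef_pV2 ?posrE ?ltr0n// ler_nat ltnS leqW ?leqnSn.
have k1 := le_lt_trans h3 h1; have k2 := le_lt_trans h3 h2.
clear h1 h2 h3.
by rewrite /I /= in_itv/=; apply/andP; split; lra.
Unshelve. all: by end_near. Qed.

Let I_sub n : I n `<=` `]0, 1[.
Proof.
move=> x; rewrite /I /= !in_itv/= => /andP[h1 h2].
by have := a_gt0 n => h; apply/andP; split; lra.
Qed.

Let I_bigcup : \bigcup_n I n = `]0, 1[%classic.
Proof.
apply/seteqP; split => [x [n _ /I_sub]//|x]; rewrite /= in_itv/= => /I_near[n _ h].
by exists n => //; exact: (h n (leqnn n)).
Qed.

Let FTC_I f F n : (forall x : R, 0 < x < 1 -> {for x, continuous f}) ->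
  (forall x : R, 0 < x < 1 -> is_derive x 1 F (f x)) ->
  (\int[mu]_(x in I n) (f x)%:E =
    (F (1 - a n) - F (a n))%:E)%E.
Proof.
move=> cf dF; have a0 := a_gt0 n; have ab := a_lt n.
have cF (x : R) : 0 < x < 1 -> {for x, continuous F}.
  move=> /dF[dFx _]; apply: differentiable_continuous.
  exact/derivable1_diffP.
rewrite EFinB /I; apply: continuous_FTC2 => //.
- apply: continuous_in_subspaceT => x; rewrite inE/= in_itv/= => /andP[h1 h2].
  by apply: cf; apply/andP; split; lra.
- split.
  + move=> x; rewrite in_itv/= => /andP[h1 h2].
    suff [] : is_derive x 1 F (f x) by [].
    by apply: dF; apply/andP; split; lra.
  + by apply: cvg_at_right_filter; apply: cF; apply/andP; split; lra.
  + by apply: cvg_at_left_filter; apply: cF; apply/andP; split; lra.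
- move=> x; rewrite in_itv/= => /andP[h1 h2].
  have h : is_derive x 1 F (f x) by apply: dF; apply/andP; split; lra.
  by rewrite derive1E derive_val.
Qed.

Let cvg_a : a n @[n --> \oo] --> (0 : R).
Proof.
have := @cvg_harmonic R; rewrite -(cvg_shiftn 2).
by apply: eq_seq_cvg => n; rewrite /a /= addn2.
Qed.

Let cvg_FI F (L0 L1 : R) : F x @[x --> 0^'+] --> L0 -> F x @[x --> 1^'-] --> L1 ->
  F (1 - a n) - F (a n) @[n --> \oo] --> L1 - L0.
Proof.
move=> /cvg_at_rightP F0 /cvg_at_leftP F1; apply: cvgB; [apply: F1|apply: F0].
  split=> [n|]; first by have := a_gt0 n; lra.
  by rewrite -[X in _ --> X]subr0; apply: cvgB => //; exact: cvg_cst.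
by split.
Qed.

Let measurable_cont f : (forall x : R, 0 < x < 1 -> {for x, continuous f}) ->
  measurable_fun `](0 : R), 1[ f.
Proof.
move=> cf; apply: open_continuous_measurable_fun; first exact: interval_open.
by move=> x; rewrite inE/= in_itv/=; exact: cf.
Qed.

(** Monotone convergence along the intervals [I n]. Integrability is not presupposed, so this can
    serve to prove it for power functions. *)
Lemma ge0_FTC_oo f F (L0 L1 : R) :
  (forall x : R, 0 < x < 1 -> {for x, continuous f}) ->
  (forall x : R, 0 < x < 1 -> 0 <= f x) ->
  (forall x : R, 0 < x < 1 -> is_derive x 1 F (f x)) ->
  F x @[x --> 0^'+] --> L0 -> F x @[x --> 1^'-] --> L1 ->
  (\int[mu]_(x in `](0 : R)%R, 1%R[) (f x)%:E = (L1 - L0)%:E)%E.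
Proof.
move=> cf f0 dF F0 F1.
have h : (\int[mu]_(x in I n) (f x)%:E @[n --> \oo] -->
    \int[mu]_(x in \bigcup_n I n) (f x)%:E)%E.
  apply: ge0_nondecreasing_set_cvg_integral => //.
  - by move=> n; exact: measurable_itv.
  - move=> n; apply/measurable_EFinP.
    by apply: measurable_funS (measurable_cont cf) => //; exact: I_sub.
  - by move=> n x /I_sub; rewrite /= in_itv/= lee_fin; exact: f0.
rewrite I_bigcup in h.
apply: (cvg_unique _ h) => //.
apply: (@cvg_trans _ ((F (1 - a n) - F (a n))%:E @[n --> \oo])).
  by apply: near_eq_cvg; near=> n; rewrite FTC_I.
by apply: cvg_EFin; [near=> n|exact: cvg_FI].
Unshelve. all: by end_near. Qed.

Lemma ge0_integrable_oo f F (L0 L1 : R) :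
  (forall x : R, 0 < x < 1 -> {for x, continuous f}) ->
  (forall x : R, 0 < x < 1 -> 0 <= f x) ->
  (forall x : R, 0 < x < 1 -> is_derive x 1 F (f x)) ->
  F x @[x --> 0^'+] --> L0 -> F x @[x --> 1^'-] --> L1 ->
  mu.-integrable `](0 : R), 1[ (EFin \o f).
Proof.
move=> cf f0 dF F0 F1; apply/integrableP; split.
  by apply/measurable_EFinP; exact: measurable_cont.
rewrite [ltLHS](_ : _ = (L1 - L0)%:E) ?ltry// -(ge0_FTC_oo cf f0 dF F0 F1).
by apply: eq_integral => x; rewrite inE/= in_itv/= => /f0 h; rewrite ger0_norm.
Qed.

(** For integrands that change sign, such as those oscillating with b ln u near 0: dominated
    convergence with |f| as bound replaces monotone convergence, hence the integrability
    hypothesis. *)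
Lemma FTC_oo f F (L0 L1 : R) :
  (forall x : R, 0 < x < 1 -> {for x, continuous f}) ->
  (forall x : R, 0 < x < 1 -> is_derive x 1 F (f x)) ->
  F x @[x --> 0^'+] --> L0 -> F x @[x --> 1^'-] --> L1 ->
  mu.-integrable `](0 : R), 1[ (EFin \o f) ->
  \int[mu]_(x in `](0 : R), 1[) f x = L1 - L0.
Proof.
move=> cf dF F0 F1 fi; rewrite /Rintegral.
suff -> : (\int[mu]_(x in `](0 : R)%R, 1%R[) (f x)%:E = (L1 - L0)%:E)%E by [].
have mfi := measurable_cont cf.
pose fn n := (EFin \o f) \_ (I n).
have mfn n : measurable_fun `](0 : R), 1[ (fn n).
  apply/(measurable_restrict _ _ _) => //; first exact: measurable_itv.
  apply: (@measurable_funS _ _ _ _ `](0 : R), 1[%classic) => //.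
  exact/measurable_EFinP.
have [_ _] := @dominated_convergence _ _ _ mu `](0 : R), 1[%classic (measurable_itv _)
  fn (EFin \o f) (abse \o (EFin \o f)) mfn ltac:(apply/measurable_EFinP; exact: mfi)
  ltac:(apply: aeW => x /=; rewrite in_itv/= => /I_near nx;
    apply: cvg_near_cst; apply: filterS nx => n nx;
    by rewrite /fn patchE mem_set)
  (integrable_abse fi)
  ltac:(apply: aeW => x n _ /=; rewrite /fn patchE; case: ifP => //;
    by rewrite abse0 lee_fin).
move=> h; apply: (cvg_unique _ h) => //.
apply: (@cvg_trans _ ((F (1 - a n) - F (a n))%:E @[n --> \oo])).
  apply: near_eq_cvg; near=> n; rewrite -(FTC_I n cf dF).
  rewrite /= -[in LHS](setIidr (@I_sub n)) integral_mkcondr.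
  by apply: eq_integral => x _; rewrite /fn !patchE.
by apply: cvg_EFin; [near=> n|exact: cvg_FI].
Unshelve. all: by end_near. Qed.

End ImproperFTC.

(** * Integrals of complex functions *)

Section ComplexIntegral.
Context {R : realType}.
Local Notation C := R[i].
Local Notation mu := (@lebesgue_measure R).
Variable D : set (measurableTypeR R).
Hypothesis mD : measurable D.
Implicit Types (f g : R -> C) (h : R -> R) (c : C).

Lemma eq_cintegral f g : (forall u, D u -> f u = g u) ->
  cintegral D f = cintegral D g.
Proof.
by move=> fg; rewrite /cintegral; congr (_ +i* _); apply: eq_Rintegral => u;
  rewrite inE => /fg ->.
Qed.

Lemma eq_cintegrable f g : (forall u, D u -> f u = g u) ->
  cintegrable D f -> cintegrable D g.
Proof.
move=> fg [fR fI]; split; [move: fR|move: fI]; apply: eq_integrable => // u;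
  by rewrite inE => /fg ->.
Qed.

Lemma cintegrable_dom f h : measurable_fun D (fun u => Re (f u)) ->
  measurable_fun D (fun u => Im (f u)) ->
  (forall u, D u -> normc (f u) <= h u) -> mu.-integrable D (EFin \o h) ->
  cintegrable D f.
Proof.
move=> mR mI fh hi; split; apply: (le_integrable mD _ _ hi) => //.
- exact/measurable_EFinP.
- move=> u Du /=; rewrite lee_fin (le_trans (ler_Re_normc _))//.
  by rewrite (le_trans (fh _ Du))// ler_norm.
- exact/measurable_EFinP.
- move=> u Du /=; rewrite lee_fin (le_trans (ler_Im_normc _))//.
  by rewrite (le_trans (fh _ Du))// ler_norm.
Qed.

(** The two parts are bounded separately. The lost factor 2 is harmless, since such bounds only
    serve convergence or contraction. *)
Lemma normc_cintegral f h : cintegrable D f ->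
  (forall u, D u -> normc (f u) <= h u) -> mu.-integrable D (EFin \o h) ->
  normc (cintegral D f) <= 2 * \int[mu]_(u in D) h u.
Proof.
move=> [fR fI] fh hi; rewrite (le_trans (ler_normc_ReIm _))//= mulr_natl mulr2n.
apply: lerD; apply: (le_trans (le_normr_Rintegral mD _)) => //.
- apply: le_Rintegral => //; first exact: integrable_norm.
  by move=> u Du; rewrite (le_trans (ler_Re_normc _))// fh.
- apply: le_Rintegral => //; first exact: integrable_norm.
  by move=> u Du; rewrite (le_trans (ler_Im_normc _))// fh.
Qed.

Lemma cintegrableD f g : cintegrable D f -> cintegrable D g ->
  cintegrable D (fun u => f u + g u).
Proof.
move=> [fR fI] [gR gI]; split.
  apply: eq_integrable (integrableD mD fR gR) => // u _ /=.
  by rewrite cReD EFinD.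
apply: eq_integrable (integrableD mD fI gI) => // u _ /=.
by rewrite cImD EFinD.
Qed.

Lemma cintegralD f g : cintegrable D f -> cintegrable D g ->
  cintegral D (fun u => f u + g u) = cintegral D f + cintegral D g.
Proof.
move=> [fR fI] [gR gI]; apply: complexP; rewrite /cintegral ?cReD ?cImD /=.
  by rewrite -RintegralD//; apply: eq_Rintegral => u _; rewrite cReD.
by rewrite -RintegralD//; apply: eq_Rintegral => u _; rewrite cImD.
Qed.

Lemma cintegrableZ c f : cintegrable D f -> cintegrable D (fun u => c * f u).
Proof.
move=> [fR fI]; split.
  apply: eq_integrable (integrableB mD (integrableZl mD (Re c) fR)
    (integrableZl mD (Im c) fI)) => // u _ /=.
  by rewrite cReM EFinB !EFinM.
apply: eq_integrable (integrableD mD (integrableZl mD (Re c) fI)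
  (integrableZl mD (Im c) fR)) => // u _ /=.
by rewrite cImM EFinD !EFinM.
Qed.

Lemma cintegralZ c f : cintegrable D f ->
  cintegral D (fun u => c * f u) = c * cintegral D f.
Proof.
move=> [fR fI]; apply: complexP; rewrite ?cReM ?cImM /=.
  rewrite -!RintegralZl// -RintegralB//; last 2 first.
  - by apply: eq_integrable (integrableZl mD (Re c) fR) => // u _ /=.
  - by apply: eq_integrable (integrableZl mD (Im c) fI) => // u _ /=.
  by apply: eq_Rintegral => u _; rewrite cReM.
rewrite -!RintegralZl// -RintegralD//; last 2 first.
- by apply: eq_integrable (integrableZl mD (Re c) fI) => // u _ /=.
- by apply: eq_integrable (integrableZl mD (Im c) fR) => // u _ /=.
by apply: eq_Rintegral => u _; rewrite cImM.
Qed.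

Lemma cintegralB f g : cintegrable D f -> cintegrable D g ->
  cintegral D (fun u => f u - g u) = cintegral D f - cintegral D g.
Proof.
move=> fi gi; rewrite -mulN1r -cintegralZ// -cintegralD//; last exact: cintegrableZ.
by apply: eq_cintegral => u _; rewrite mulN1r.
Qed.

(** * Termwise integration under a product bound *)

Section DominatedSeries.
Variables (F : nat -> R -> C) (b : nat -> R) (h : R -> R).
Hypothesis mR : forall n, measurable_fun D (fun u => Re (F n u)).
Hypothesis mI : forall n, measurable_fun D (fun u => Im (F n u)).
Hypothesis hi : mu.-integrable D (EFin \o h).
Hypothesis cb : cvgn (series b).
Hypothesis Fb : forall n u, D u -> normc (F n u) <= b n * h u.
Hypothesis b_ge0 : forall n, 0 <= b n.
Hypothesis h_ge0 : forall u, D u -> 0 <= h u.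

Let cbh u : cvgn (series (fun n => b n * h u)).
Proof.
have -> : series (fun n => b n * h u) = (fun n => series b n * h u).
  by apply/funext => n; rewrite /series /= mulr_suml.
exact: is_cvgMr_tmp.
Qed.

Let cF u : D u -> csummable (F ^~ u).
Proof. by move=> Du; apply: (csummable_dom (fun n => Fb n Du)). Qed.

Let bh_bound n u : D u -> series (fun n => b n * h u) n <= limn (series b) * h u.
Proof.
move=> Du; have -> : series (fun n => b n * h u) n = series b n * h u.
  by rewrite /series /= mulr_suml.
rewrite ler_wpM2r ?h_ge0//; apply: nondecreasing_cvgn_le => //.
exact: nondecreasing_series.
Qed.

Let bhi n : mu.-integrable D (EFin \o (fun u => b n * h u)).
Proof. by apply: eq_integrable (integrableZl mD (b n) hi) => // u _ /=. Qed.

Let Bhi : mu.-integrable D (EFin \o (fun u => limn (series b) * h u)).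
Proof. by apply: eq_integrable (integrableZl mD (limn (series b)) hi) => // u _ /=. Qed.

(** Dominated convergence of the partial sums: since the bound splits as b n times h u, the single
    function (sum b) h dominates them all. *)
Let real_dominated (G : nat -> R -> R) (G_ : R -> R) :
  (forall n, measurable_fun D (G n)) ->
  (forall n u, D u -> `|G n u| <= b n * h u) ->
  (forall u, D u -> series (G ^~ u) @ \oo --> G_ u) ->
  mu.-integrable D (EFin \o G_) /\
  series (fun n => \int[mu]_(u in D) G n u) @ \oo --> \int[mu]_(u in D) G_ u.
Proof.
move=> mG Gb cG.
have Gi n : mu.-integrable D (EFin \o G n).
  apply: (le_integrable mD _ _ (bhi n)); first exact/measurable_EFinP.
  move=> u Du /=; rewrite lee_fin (le_trans (Gb n u Du))//.
  exact: ler_norm.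
pose S n u := series (G ^~ u) n.
have mS n : measurable_fun D (S n).
  by rewrite /S /series /=; apply: measurable_sum => k.
have cS u : D u -> (S n u)%:E @[n --> \oo] --> (G_ u)%:E.
  by move=> Du; apply: cvg_EFin; [near=> n|exact: cG].
have mG_ : measurable_fun D (EFin \o G_).
  apply: (emeasurable_fun_cvg (fun n => EFin \o S n)) => //.
  by move=> n; apply/measurable_EFinP; exact: mS.
have SB n u : D u -> (`|(S n u)%:E| <= (limn (series b) * h u)%:E)%E.
  move=> Du; rewrite lee_fin (le_trans _ (bh_bound n Du))//.
  by rewrite (le_trans (ler_norm_sum _ _ _))// ler_sum// => k _; exact: Gb.
have mES n : measurable_fun D (EFin \o S n).
  by apply/measurable_EFinP; exact: mS.
have [G_i _ lim] := @dominated_convergence _ _ _ mu D mD (fun n => EFin \o S n)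
  (EFin \o G_) _ mES mG_
  (aeW _ cS) Bhi (aeW _ (fun u n Du => SB n u Du)).
split => //.
have Si n : (\int[mu]_(u in D) (S n u)%:E =
    (series (fun n => \int[mu]_(u in D) G n u) n)%:E)%E.
  elim: n => [|n ih].
    rewrite /series /= big_geq//.
    by rewrite integral0_eq// => u Du; rewrite /S /series /= big_geq.
  rewrite seriesSr EFinD -ih.
  rewrite /Rintegral fineK; last by apply: integrable_fin_num => //; exact: Gi.
  rewrite -integralD//.
    by apply: eq_integral => u _; rewrite /S seriesSr EFinD.
  apply: (le_integrable mD _ _ Bhi); first exact/measurable_EFinP.
  move=> u Du /=; rewrite (le_trans (SB n u Du))// lee_fin ler_norm//.
  exact: Gi.
have lim' : (series (fun n => \int[mu]_(u in D) G n u) n)%:E @[n --> \oo] -->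
    (\int[mu]_(u in D) G_ u)%:E.
  rewrite /Rintegral fineK; last by apply: integrable_fin_num.
  by apply: eq_seq_cvg lim => n; rewrite -Si.
exact: (fine_cvg lim').
Unshelve. all: by end_near. Qed.

Let cRe u : D u -> series ((fun n => Re (F n u)) : nat -> R) @ \oo --> Re (csum (F ^~ u)).
Proof.
move=> Du; have /ccvgP[h1 _] := csum_cvg (cF Du).
by apply: eq_seq_cvg h1 => n; rewrite Re_series.
Qed.

Let cIm u : D u -> series ((fun n => Im (F n u)) : nat -> R) @ \oo --> Im (csum (F ^~ u)).
Proof.
move=> Du; have /ccvgP[_ h1] := csum_cvg (cF Du).
by apply: eq_seq_cvg h1 => n; rewrite Im_series.
Qed.

Let Re_dom := real_dominated mR
  (fun n u Du => le_trans (ler_Re_normc _) (Fb n Du)) cRe.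
Let Im_dom := real_dominated mI
  (fun n u Du => le_trans (ler_Im_normc _) (Fb n Du)) cIm.

Lemma cintegrable_csum : cintegrable D (fun u => csum (F ^~ u)).
Proof. by split; [exact: Re_dom.1|exact: Im_dom.1]. Qed.

Lemma cvg_cintegral_csum :
  (series ((fun n => cintegral D (F n)) : nat -> C^o) @ \oo -->
    (cintegral D (fun u => csum (F ^~ u)) : C^o)).
Proof.
apply/ccvgP; split.
  by apply: eq_seq_cvg Re_dom.2 => n; rewrite Re_series.
by apply: eq_seq_cvg Im_dom.2 => n; rewrite Im_series.
Qed.

Lemma normc_csum_dom u : D u -> normc (csum (F ^~ u)) <= limn (series b) * h u.
Proof.
move=> Du; rewrite (le_trans (normc_csum (fun n => Fb n Du) (@cbh u)))//.
apply: limr_le => //; near=> n; exact: bh_bound.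
Unshelve. all: by end_near. Qed.

End DominatedSeries.
End ComplexIntegral.

(** * The Beta integral *)

Section BetaKernel.
Context {R : realType}.
Local Notation C := R[i].
Local Notation mu := (@lebesgue_measure R).
Local Notation D := (`](0 : R), 1[%classic : set (measurableTypeR R)).
Implicit Types (z w : C) (a b e x u v : R).

Let mD : measurable D. Proof. exact: measurable_itv. Qed.

(** The endpoints form a null set. Leaving them out keeps u and 1 - u positive, as the rules for
    real powers require. *)
Lemma cintegrable_itvcc (g : R -> C) :
  cintegrable (`[(0 : R), 1]%classic : set (measurableTypeR R)) g <->
  cintegrable D g.
Proof.
have key (f : R -> R) :
    mu.-integrable (`[(0 : R), 1]%classic : set (measurableTypeR R)) (EFin \o f) <->
    mu.-integrable D (EFin \o f).
  split=> fi.
    by apply: (integrableS _ _ _ fi) => //; exact: subset_itv_oo_cc.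
  have [mf fioo] := integrableP _ _ _ fi.
  have mfcc : measurable_fun (`[(0 : R), 1]%classic : set (measurableTypeR R)) (EFin \o f).
    by apply/emeasurable_fun_itv_bndo_bndcP/emeasurable_fun_itv_obnd_cbndP.
  apply/integrableP; split => //.
  rewrite -integral_itv_bndo_bndc; last first.
    by apply/emeasurable_fun_itv_obnd_cbndP; apply: measurableT_comp.
  rewrite -integral_itv_obnd_cbnd//; exact: measurableT_comp.
by split=> -[fR fI]; split; apply/(key _).
Qed.

Lemma cintegral_itvcc (g : R -> C) : cintegrable D g ->
  cintegral (`[(0 : R), 1]%classic : set (measurableTypeR R)) g = cintegral D g.
Proof.
move=> [gR gI]; rewrite /cintegral; congr (_ +i* _).
  rewrite -Rintegral_itv_bndo_bndc ?Rintegral_itv_obnd_cbnd//.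
  by have [+ _] := (cintegrable_itvcc g).2 (conj gR gI);
    move=> h; apply: (integrableS _ _ _ h) => // x /=;
    rewrite !in_itv/= => /andP[-> /ltW].
rewrite -Rintegral_itv_bndo_bndc ?Rintegral_itv_obnd_cbnd//.
by have [_ +] := (cintegrable_itvcc g).2 (conj gR gI);
  move=> h; apply: (integrableS _ _ _ h) => // x /=;
  rewrite !in_itv/= => /andP[-> /ltW].
Qed.

Lemma D_gt0 u : D u -> 0 < u. Proof. by rewrite /= in_itv/= => /andP[]. Qed.
Lemma D_lt1 u : D u -> u < 1. Proof. by rewrite /= in_itv/= => /andP[]. Qed.
Lemma D_onem u : D u -> 0 < 1 - u. Proof. by move=> /D_lt1; rewrite subr_gt0. Qed.

Lemma powR_le1 u e : 0 < u -> u <= 1 -> 0 <= e -> u `^ e <= 1.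
Proof. by move=> u0 u1 e0; rewrite /powR gt_eqF// -expR0 ler_expR mulr_ge0_le0// ln_le0. Qed.

Lemma is_derive_onem_powR e x : x < 1 ->
  is_derive x 1 (fun u => (1 - u) `^ e) (- (e * (1 - x) `^ (e - 1))).
Proof.
move=> x1; have h : 0 < 1 - x by rewrite subr_gt0.
have h1 := is_derive1_powR e h.
have h2 : is_derive x 1 (fun u : R => 1 - u) (- 1) by apply: is_derive_eq; ring.
by have := @is_derive1_comp R (@powR R ^~ e) (fun u => 1 - u) x _ _ h1 h2;
  rewrite mulrN1.
Qed.

Lemma continuous_powR e x : 0 < x -> {for x, continuous (@powR R ^~ e)}.
Proof.
move=> x0; apply: differentiable_continuous; apply/derivable1_diffP.
by have [] := is_derive1_powR e x0.
Qed.

Lemma continuous_onem_powR e x : x < 1 ->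
  {for x, continuous (fun u => (1 - u) `^ e)}.
Proof.
move=> x1; apply: differentiable_continuous; apply/derivable1_diffP.
by have [] := is_derive_onem_powR e x1.
Qed.

Lemma cvg_onem_powR0 e : 0 < e -> (1 - u) `^ e @[u --> 1^'-] --> 0.
Proof.
move=> e0; apply/cvg_at_leftP => s [s1 cs].
have /cvg_at_rightP h := powR_cvg0 e0.
apply: (h (fun n => 1 - s n)); split=> [n|]; first by rewrite subr_gt0.
by rewrite -[X in _ --> X](subrr 1); apply: cvgB => //; exact: cvg_cst.
Qed.

Lemma measurable_onem_powR e :
  measurable_fun [set: measurableTypeR R] (fun u => (1 - u) `^ e).
Proof.
have h : measurable_fun [set: measurableTypeR R] (@powR R ^~ e).
  exact: measurable_powR.
have h2 : measurable_fun [set: measurableTypeR R] (fun u : R => 1 - u).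
  exact: measurable_funB.
exact: (measurableT_comp h h2).
Qed.

Lemma integrable_powR e : 0 < e -> mu.-integrable D (EFin \o (fun u => u `^ (e - 1))).
Proof.
move=> e0; apply: (@ge0_integrable_oo _ _ (fun u => e^-1 * u `^ e) 0 e^-1).
- by move=> x /andP[x0 _]; exact: continuous_powR.
- by move=> x _; exact: powR_ge0.
- move=> x /andP[x0 _]; have h := is_derive1_powR e x0.
  by apply: is_derive_eq; rewrite /GRing.scale /=; field; rewrite gt_eqF.
- by rewrite -[X in _ --> X](mulr0 e^-1); apply: cvgMl_tmp; exact: powR_cvg0.
- rewrite -[X in _ --> X](mulr1 e^-1); apply: cvgMl_tmp.
  have e1 : 1 = 1 `^ e :> R by rewrite powR1.
  rewrite [X in _ --> X]e1; apply: cvg_at_left_filter.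
  exact: continuous_powR.
Qed.

Lemma onem_powR_FTC e : 0 < e ->
  (\int[mu]_(u in D) ((1 - u) `^ (e - 1))%:E = (e^-1)%:E)%E /\
  mu.-integrable D (EFin \o (fun u => (1 - u) `^ (e - 1))).
Proof.
move=> e0; pose F u := - (e^-1 * (1 - u) `^ e).
have cf x : 0 < x < 1 -> {for x, continuous (fun u => (1 - u) `^ (e - 1))}.
  by move=> /andP[_ x1]; exact: continuous_onem_powR.
have f0 x : 0 < x < 1 -> 0 <= (1 - x) `^ (e - 1) by move=> _; exact: powR_ge0.
have dF x : 0 < x < 1 -> is_derive x 1 F ((1 - x) `^ (e - 1)).
  move=> /andP[_ x1]; have h := is_derive_onem_powR e x1.
  by apply: is_derive_eq; rewrite /GRing.scale /=; field; rewrite gt_eqF.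
have F0 : F x @[x --> 0^'+] --> - e^-1.
  rewrite -[X in - X](mulr1 e^-1); apply: cvgN; apply: cvgMl_tmp.
  have e1 : 1 = 1 `^ e :> R by rewrite powR1.
  rewrite [X in _ --> X]e1 -{2}[1]subr0.
  apply: (@cvg_at_right_filter _ _ (fun u => (1 - u) `^ e)).
  exact: continuous_onem_powR.
have F1 : F x @[x --> 1^'-] --> 0.
  rewrite -oppr0 -(mulr0 e^-1); apply: cvgN; apply: cvgMl_tmp.
  exact: cvg_onem_powR0.
split; last exact: (ge0_integrable_oo cf f0 dF F0 F1).
by rewrite (ge0_FTC_oo cf f0 dF F0 F1) opprK add0r.
Qed.

Definition betak a b u : R := u `^ (a - 1) * (1 - u) `^ (b - 1).

Lemma betak_ge0 a b u : 0 <= betak a b u.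
Proof. by rewrite mulr_ge0 ?powR_ge0. Qed.

Lemma measurable_betak a b : measurable_fun D (betak a b).
Proof.
apply: measurable_funTS; apply: measurable_funM; first exact: measurable_powR.
exact: measurable_onem_powR.
Qed.

Lemma powRS u e : 0 < u -> u `^ e = u * u `^ (e - 1).
Proof.
move=> u0; rewrite -{2}[u]powRr1 ?ltW// -powRD; first by rewrite addrC subrK.
by rewrite (gt_eqF u0) implybT.
Qed.

Lemma betak_split a b u : D u -> betak a b u = betak (a + 1) b u + betak a (b + 1) u.
Proof.
move=> Du; have u0 := D_gt0 Du; have u1 := D_onem Du.
by rewrite /betak !addrK (powRS a u0) (powRS b u1); ring.
Qed.

(** If one parameter is at least 1, its factor is at most 1 and the other factor is integrable
    alone. The general case uses 1 = u + (1 - u), which raises one parameter in each summand. *)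
Lemma integrable_betak a b : 0 < a -> 0 < b -> mu.-integrable D (EFin \o betak a b).
Proof.
have wlog1 a' b' : 0 < a' -> 1 <= b' -> mu.-integrable D (EFin \o betak a' b').
  move=> a0 b1; apply: (le_integrable mD _ _ (integrable_powR a0)).
    by apply/measurable_EFinP; exact: measurable_betak.
  move=> u Du /=; rewrite lee_fin ger0_norm ?betak_ge0// ger0_norm ?powR_ge0//.
  rewrite ler_piMr ?powR_ge0//; apply: powR_le1; first exact: D_onem.
    by rewrite lerBlDr lerDl ltW// D_gt0.
  by rewrite subr_ge0.
have wlog2 a' b' : 1 <= a' -> 0 < b' -> mu.-integrable D (EFin \o betak a' b').
  move=> a1 b0; apply: (le_integrable mD _ _ (onem_powR_FTC b0).2).
    by apply/measurable_EFinP; exact: measurable_betak.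
  move=> u Du /=; rewrite lee_fin ger0_norm ?betak_ge0// ger0_norm ?powR_ge0//.
  rewrite ler_piMl ?powR_ge0//; apply: powR_le1; first exact: D_gt0.
    by rewrite ltW// D_lt1.
  by rewrite subr_ge0.
move=> a0 b0.
have i1 : mu.-integrable D (EFin \o betak (a + 1) b) by apply: wlog2 => //; lra.
have i2 : mu.-integrable D (EFin \o betak a (b + 1)) by apply: wlog1 => //; lra.
apply: eq_integrable (integrableD mD i1 i2) => // u.
by rewrite inE => Du /=; rewrite -EFinD -betak_split.
Qed.

End BetaKernel.

(** * Beta integrals with a complex first parameter *)

Section ComplexBeta.
Context {R : realType}.
Local Notation C := R[i].
Local Notation mu := (@lebesgue_measure R).
Local Notation D := (`](0 : R), 1[%classic : set (measurableTypeR R)).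
Implicit Types (z w : C) (a b e x u v : R).

Let mD : measurable D. Proof. exact: measurable_itv. Qed.

Definition cbetak z v u : C := cpow u%:C (z - 1) * ((1 - u) `^ (v - 1))%:C.

Definition cbeta z v : C := cintegral D (cbetak z v).

Lemma normc_cbetak z v u : D u -> normc (cbetak z v u) = betak (Re z) v u.
Proof.
move=> Du; rewrite Normc.normcM normc_cpow_real ?(D_gt0 Du)// normc_real.
by rewrite ger0_norm ?powR_ge0// cReB.
Qed.

Lemma Re_cbetak z v u : 0 < u ->
  Re (cbetak z v u) = u `^ (Re z - 1) * cos (Im z * ln u) * (1 - u) `^ (v - 1).
Proof. by move=> u0; rewrite [cbetak z v u]mulrC cReZ Re_cpow_real// cReB cImB /= subr0 [LHS]mulrC. Qed.

Lemma Im_cbetak z v u : 0 < u ->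
  Im (cbetak z v u) = u `^ (Re z - 1) * sin (Im z * ln u) * (1 - u) `^ (v - 1).
Proof. by move=> u0; rewrite [cbetak z v u]mulrC cImZ Im_cpow_real// cReB cImB /= subr0 [LHS]mulrC. Qed.

Lemma measurable_osc (h : R -> R) a b : continuous h ->
  measurable_fun [set: measurableTypeR R] (fun u : R => u `^ a * h (b * ln u)).
Proof.
move=> ch.
have h1 : measurable_fun [set: measurableTypeR R] (@powR R ^~ a).
  exact: measurable_powR.
have h2 : measurable_fun [set: measurableTypeR R] (@ln R) by exact: measurable_ln.
have h3 : measurable_fun [set: measurableTypeR R] (fun u : R => b * ln u).
  exact: (measurable_funM (measurable_cst _) h2).
have h4 : measurable_fun [set: measurableTypeR R] h.
  exact: continuous_measurable_fun.
exact: (measurable_funM h1 (measurableT_comp h4 h3)).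
Qed.

Lemma measurable_Re_cpow w : measurable_fun D (fun u : R => Re (cpow u%:C w)).
Proof.
apply: (@eq_measurable_fun _ _ _ _ D (fun u : R => u `^ Re w * cos (Im w * ln u))).
  by move=> u; rewrite inE => Du; rewrite Re_cpow_real// (D_gt0 Du).
by apply: measurable_funTS; apply: measurable_osc; exact: continuous_cos.
Qed.

Lemma measurable_Im_cpow w : measurable_fun D (fun u : R => Im (cpow u%:C w)).
Proof.
apply: (@eq_measurable_fun _ _ _ _ D (fun u : R => u `^ Re w * sin (Im w * ln u))).
  by move=> u; rewrite inE => Du; rewrite Im_cpow_real// (D_gt0 Du).
by apply: measurable_funTS; apply: measurable_osc; exact: continuous_sin.
Qed.

Lemma measurable_Re_cbetak z v : measurable_fun D (fun u => Re (cbetak z v u)).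
Proof.
apply: (@eq_measurable_fun _ _ _ _ D
  (fun u => (1 - u) `^ (v - 1) * Re (cpow u%:C (z - 1)))).
  by move=> u _; rewrite /cbetak [in RHS]mulrC cReZ.
apply: measurable_funM; last exact: measurable_Re_cpow.
by apply: measurable_funTS; exact: measurable_onem_powR.
Qed.

Lemma measurable_Im_cbetak z v : measurable_fun D (fun u => Im (cbetak z v u)).
Proof.
apply: (@eq_measurable_fun _ _ _ _ D
  (fun u => (1 - u) `^ (v - 1) * Im (cpow u%:C (z - 1)))).
  by move=> u _; rewrite /cbetak [in RHS]mulrC cImZ.
apply: measurable_funM; last exact: measurable_Im_cpow.
by apply: measurable_funTS; exact: measurable_onem_powR.
Qed.

Lemma cintegrable_cbetak z v : 0 < Re z -> 0 < v -> cintegrable D (cbetak z v).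
Proof.
move=> z0 v0; apply: (cintegrable_dom mD (h := betak (Re z) v)).
- exact: measurable_Re_cbetak.
- exact: measurable_Im_cbetak.
- by move=> u Du; rewrite normc_cbetak.
- exact: integrable_betak.
Qed.

Lemma normc_cbeta z v : 0 < Re z -> 0 < v ->
  normc (cbeta z v) <= 2 * \int[mu]_(u in D) betak (Re z) v u.
Proof.
move=> z0 v0; apply: normc_cintegral => //; first exact: cintegrable_cbetak.
  by move=> u Du; rewrite normc_cbetak.
exact: integrable_betak.
Qed.

Lemma cpow_realS z u : 0 < u -> cpow u%:C z = u%:C * cpow u%:C (z - 1).
Proof.
move=> u0; have u0' : u%:C != 0 :> C by rewrite real_complex_eq0 gt_eqF.
by rewrite -{2}(cpowr1 u0') -cpowD// addrC subrK.
Qed.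

Lemma cbeta_split z v : 0 < Re z -> 0 < v ->
  cbeta z v = cbeta (z + 1) v + cbeta z (v + 1).
Proof.
move=> z0 v0; rewrite /cbeta -cintegralD//; last 2 first.
- by apply: cintegrable_cbetak => //; rewrite cReD /= addr_gt0.
- by apply: cintegrable_cbetak => //; rewrite addr_gt0.
apply: eq_cintegral => u Du; rewrite /cbetak !addrK.
rewrite (cpow_realS z (D_gt0 Du)) (powRS v (D_onem Du)).
by rewrite real_complexM real_complexB; ring.
Qed.

Section IntegrationByParts.
Variables (z : C) (v : R).
Hypotheses (z0 : 0 < Re z) (v0 : 0 < v).
Let a := Re z.
Let b := Im z.

(** The derivative of u^z (1 - u)^v, which vanishes at both ends; that its integral is 0 is the
    integration by parts. *)
Let g u : C := z * cbetak z (v + 1) u - v%:C * cbetak (z + 1) v u.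

Let gi : cintegrable D g.
Proof.
have h1 : cintegrable D (cbetak z (v + 1)).
  by apply: cintegrable_cbetak => //; rewrite addr_gt0.
have h2 : cintegrable D (cbetak (z + 1) v).
  by apply: cintegrable_cbetak => //; rewrite cReD /= addr_gt0.
have := cintegrableD mD (cintegrableZ mD z h1) (cintegrableZ mD (- v%:C) h2).
by apply: eq_cintegrable => // u _; rewrite mulNr.
Qed.

Let is_derive_oscc x : 0 < x ->
  is_derive x 1 (fun u : R => cos (b * ln u)) (- (b / x) * sin (b * ln x)).
Proof.
move=> x0; have h := is_derive1_ln x0.
have h2 : is_derive x 1 (fun u : R => b * ln u) (b / x).
  by apply: is_derive_eq; rewrite /GRing.scale /=; ring.
have := @is_derive1_comp R (@cos R) (fun u => b * ln u) x _ _ (is_derive_cos _) h2.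
by move=> h3; apply: is_derive_eq; ring.
Qed.

Let is_derive_oscs x : 0 < x ->
  is_derive x 1 (fun u : R => sin (b * ln u)) (b / x * cos (b * ln x)).
Proof.
move=> x0; have h := is_derive1_ln x0.
have h2 : is_derive x 1 (fun u : R => b * ln u) (b / x).
  by apply: is_derive_eq; rewrite /GRing.scale /=; ring.
have := @is_derive1_comp R (@sin R) (fun u => b * ln u) x _ _ (is_derive_sin _) h2.
by move=> h3; apply: is_derive_eq; ring.
Qed.

Let continuous_osc (h : R -> R) x : continuous h -> 0 < x ->
  {for x, continuous (fun u : R => h (b * ln u))}.
Proof.
move=> ch x0; apply: (@continuous_comp _ _ _ (fun u : R => b * ln u) h); last exact: ch.
by apply: cvgMl_tmp; exact: continuous_ln.
Qed.

(** Near 0 the factor u^a decides, near 1 the factor (1 - u)^v, whatever the bounded oscillation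
    [h], which will be the cosine or the sine. *)
Let squeeze (h : R -> R) : (forall y, `|h y| <= 1) ->
  (u `^ a * h (b * ln u) * (1 - u) `^ v @[u --> 0^'+] --> (0 : R)) /\
  (u `^ a * h (b * ln u) * (1 - u) `^ v @[u --> 1^'-] --> (0 : R)).
Proof.
move=> h1; split.
  apply: (@squeeze_cvgr _ _ _ _ (fun u => - u `^ a) (fun u => u `^ a)).
  - near=> u.
    have u0 : 0 < u by near: u; exact: nbhs_right_gt.
    have u1 : u < 1 by near: u; exact: nbhs_right_lt.
    rewrite -ler_norml !normrM (ger0_norm (powR_ge0 _ _)) (ger0_norm (powR_ge0 (1 - u) _)).
    rewrite -mulrA ler_piMr ?powR_ge0// mulr_ile1 ?powR_ge0//.
    by apply: powR_le1; rewrite ?subr_gt0 ?lerBlDr ?lerDl// ltW.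
  - by rewrite -[X in _ --> X]oppr0; apply: cvgN; exact: (powR_cvg0 z0).
  - exact: (powR_cvg0 z0).
apply: (@squeeze_cvgr _ _ _ _ (fun u => - (1 - u) `^ v) (fun u => (1 - u) `^ v)).
- near=> u.
  have u0 : 0 < u by near: u; exact: nbhs_left_gt.
  have u1 : u < 1 by near: u; exact: nbhs_left_lt.
  rewrite -ler_norml !normrM (ger0_norm (powR_ge0 _ _)) (ger0_norm (powR_ge0 (1 - u) _)).
  rewrite ler_piMl ?powR_ge0// mulr_ile1 ?powR_ge0//.
  by apply: powR_le1 => //; rewrite ltW.
- by rewrite -[X in _ --> X]oppr0; apply: cvgN; exact: (cvg_onem_powR0 v0).
- exact: (cvg_onem_powR0 v0).
Unshelve. all: by end_near. Qed.

Let fR u := (a * (u `^ (a - 1) * cos (b * ln u)) - b * (u `^ (a - 1) * sin (b * ln u))) * (1 - u) `^ v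
  - v * (u `^ a * cos (b * ln u) * (1 - u) `^ (v - 1)).
Let fI u := (a * (u `^ (a - 1) * sin (b * ln u)) + b * (u `^ (a - 1) * cos (b * ln u))) * (1 - u) `^ v
  - v * (u `^ a * sin (b * ln u) * (1 - u) `^ (v - 1)).

Let Re_g u : 0 < u -> Re (g u) = fR u.
Proof.
move=> u0; rewrite /g cReB cReZ cReM !Re_cbetak// Im_cbetak// cReD cImD /=.
by rewrite addr0 !addrK -/a -/b /fR; ring.
Qed.

Let Im_g u : 0 < u -> Im (g u) = fI u.
Proof.
move=> u0; rewrite /g cImB cImZ cImM !Im_cbetak// Re_cbetak// cReD cImD /=.
by rewrite addr0 !addrK -/a -/b /fI; ring.
Qed.

Let cintegral_g : cintegral D g = 0.
Proof.
have [gR gI] := gi; apply: complexP; rewrite /cintegral /=.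
  transitivity (\int[mu]_(u in D) fR u).
    by apply: eq_Rintegral => u; rewrite inE => Du; rewrite Re_g// (D_gt0 Du).
  rewrite -[RHS](subrr 0).
  have [s0 s1] := squeeze (fun y => cos_max y).
  apply: (@FTC_oo _ _ (fun u => u `^ a * cos (b * ln u) * (1 - u) `^ v)) => //.
  - move=> x /andP[x0 x1].
    have c1 := continuous_osc (@continuous_cos R) x0.
    have c2 := continuous_osc (@continuous_sin R) x0.
    have c3 := continuous_powR (e := a - 1) x0.
    have c4 := continuous_powR (e := a) x0.
    have c5 := continuous_onem_powR (e := v) x1.
    have c6 := continuous_onem_powR (e := v - 1) x1.
    apply: cvgB; first apply: cvgM => //; first apply: cvgB.
    + by apply: cvgMl_tmp; apply: cvgM.
    + by apply: cvgMl_tmp; apply: cvgM.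
    + by apply: cvgMl_tmp; apply: cvgM => //; apply: cvgM.
  - move=> x /andP[x0 x1].
    have d1 := is_derive1_powR a x0.
    have d2 := is_derive_oscc x0.
    have d3 := is_derive_onem_powR v x1.
    apply: is_derive_eq; rewrite /GRing.scale /= /fR (powRS a x0).
    by field; rewrite gt_eqF.
  - apply: eq_integrable gR => // u.
    by rewrite inE => Du /=; rewrite Re_g// (D_gt0 Du).
transitivity (\int[mu]_(u in D) fI u).
  by apply: eq_Rintegral => u; rewrite inE => Du; rewrite Im_g// (D_gt0 Du).
rewrite -[RHS](subrr 0).
have [s0 s1] := squeeze (fun y => sin_max y).
apply: (@FTC_oo _ _ (fun u => u `^ a * sin (b * ln u) * (1 - u) `^ v)) => //.
- move=> x /andP[x0 x1].
  have c1 := continuous_osc (@continuous_cos R) x0.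
  have c2 := continuous_osc (@continuous_sin R) x0.
  have c3 := continuous_powR (e := a - 1) x0.
  have c4 := continuous_powR (e := a) x0.
  have c5 := continuous_onem_powR (e := v) x1.
  have c6 := continuous_onem_powR (e := v - 1) x1.
  apply: cvgB; first apply: cvgM => //; first apply: cvgD.
  + by apply: cvgMl_tmp; apply: cvgM.
  + by apply: cvgMl_tmp; apply: cvgM.
  + by apply: cvgMl_tmp; apply: cvgM => //; apply: cvgM.
- move=> x /andP[x0 x1].
  have d1 := is_derive1_powR a x0.
  have d2 := is_derive_oscs x0.
  have d3 := is_derive_onem_powR v x1.
  apply: is_derive_eq; rewrite /GRing.scale /= /fI (powRS a x0).
  by field; rewrite gt_eqF.
- apply: eq_integrable gI => // u.
  by rewrite inE => Du /=; rewrite Im_g// (D_gt0 Du).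
Qed.

Lemma cbeta_by_parts : z * cbeta z (v + 1) = v%:C * cbeta (z + 1) v.
Proof.
have h1 : cintegrable D (cbetak z (v + 1)).
  by apply: cintegrable_cbetak => //; rewrite addr_gt0.
have h2 : cintegrable D (cbetak (z + 1) v).
  by apply: cintegrable_cbetak => //; rewrite cReD /= addr_gt0.
apply/eqP; rewrite -subr_eq0; apply/eqP.
rewrite /cbeta -!cintegralZ// -cintegralB//; exact: cintegrableZ.
Qed.

(** Splitting by 1 = u + (1 - u), then integration by parts in the second summand. *)
Lemma cbetaS : (z + v%:C) * cbeta (z + 1) v = z * cbeta z v.
Proof. by rewrite (cbeta_split z0 v0) mulrDl mulrDr -cbeta_by_parts. Qed.

End IntegrationByParts.
End ComplexBeta.

(** * From Beta integrals to the Gamma function *)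

Section BetaGamma.
Context {R : realType}.
Local Notation C := R[i].
Local Notation mu := (@lebesgue_measure R).
Local Notation D := (`](0 : R), 1[%classic : set (measurableTypeR R)).
Implicit Types (z w : C) (a b e x u : R).

Let mD : measurable D. Proof. exact: measurable_itv. Qed.

Section FixedExponents.
Variables (z : C) (v : R).
Hypotheses (z0 : 0 < Re z) (v0 : 0 < v).

Let Re_addn w n : 0 < Re w -> 0 < Re (w + n%:R).
Proof. by move=> w0; rewrite cReD Re_nat ltr_wpDr. Qed.

Lemma cbeta_prod w n : 0 < Re w ->
  cbeta w v * \prod_(i < n) (w + i%:R) =
  cbeta (w + n%:R) v * \prod_(i < n) (w + v%:C + i%:R).
Proof.
move=> w0; elim: n => [|n ih]; first by rewrite !big_ord0 addr0.
have e := cbetaS (Re_addn n w0) v0.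
rewrite !big_ord_recr /= mulrA ih -natr1 [w + (_ + 1)]addrA.
rewrite mulrAC [_ * (w + n%:R)]mulrC -e; ring.
Qed.

Lemma cbeta1 : cbeta 1 v = (v^-1)%:C.
Proof.
have [e h] := onem_powR_FTC v0.
apply: complexP; rewrite /cbeta /cintegral /=.
  rewrite /Rintegral -[v^-1]/(fine (v^-1)%:E) -e; congr fine.
  apply: eq_integral => u; rewrite inE => Du.
  by rewrite Re_cbetak ?(D_gt0 Du)//= subrr powRr0 mul0r cos0 !mul1r.
rewrite /Rintegral integral0_eq// => u Du.
by rewrite Im_cbetak ?(D_gt0 Du)//= mul0r sin0 mulr0 mul0r.
Qed.

(** Started at B(1, v) = 1/v, the recurrence yields exactly the factorial and the product that occur
    in [gauss] at [v]. *)
Lemma cbeta_nat n :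
  cbeta n.+1%:R v * \prod_(i < n.+1) (v%:C + i%:R) = n`!%:R.
Proof.
elim: n => [|n ih].
  rewrite big_ord_recr big_ord0 /= mul1r addr0 cbeta1 -real_complexM.
  by rewrite mulVf ?gt_eqF.
have h : 0 < Re (n.+1%:R : C) by rewrite Re_nat.
have e := cbetaS h v0; rewrite big_ord_recr /= factS natrM -ih -[n.+2%:R]natr1.
rewrite [RHS]mulrA -e; ring.
Qed.

Lemma cbeta_nat_neq0 n : cbeta n.+1%:R v != 0.
Proof.
apply/eqP => h; have := cbeta_nat n; rewrite h mul0r => /esym/eqP.
by rewrite pnatr_eq0 -leqn0 leqNgt fact_gt0.
Qed.

(* Passing to the limit gives the Beta-Gamma formula, the quotient of Beta
   integrals on the left tending to [1]. *)
Lemma gauss_cbeta n : gauss z n.+1 * gauss v%:C n.+1 *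
    (cbeta (z + n.+2%:R) v / cbeta n.+2%:R v) =
  gauss (z + v%:C) n.+1 * cbeta z v.
Proof.
have v0' : 0 < Re v%:C by [].
have zv0 : 0 < Re (z + v%:C) by rewrite cReD addr_gt0.
have P1 := gauss_prod_neq0 z0 n.+2; have P2 := gauss_prod_neq0 v0' n.+2.
have P3 := gauss_prod_neq0 zv0 n.+2.
have e1 := cbeta_prod n.+2 z0; have e2 := cbeta_nat n.+1.
have nz := cbeta_nat_neq0 n.+1.
have n0 : n.+1%:R != 0 :> C by rewrite pnatr_eq0.
rewrite /gauss (cpowD _ _ n0).
move: P1 P2 P3 e1 e2 nz.
move: (\prod_(i < n.+2) (z + i%:R)) (\prod_(i < n.+2) (v%:C + i%:R))
  (\prod_(i < n.+2) (z + v%:C + i%:R)) => p q r.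
move: (cbeta n.+2%:R v) (cbeta (z + n.+2%:R) v) (cbeta z v) (n.+1`!%:R) => y x s f.
move: (cpow n.+1%:R z) (cpow n.+1%:R v%:C) => A B p0 q0 r0 e1 e2 y0.
have -> : f = y * q by [].
have -> : s = x * r / p by rewrite -e1 mulfK.
by field; rewrite p0 q0 r0 y0.
Qed.

(** As Re (z ln u) may be positive or not only through z, its sign is fixed by Re z > 0 and ln u <=
    0; so |u^z - 1| <= 2 |z| |ln u|, and -ln u = ln (1 + (1 - u)/u) <= (1 - u)/u. *)
Let cpow_sub1_bound u : D u -> normc (cpow u%:C z - 1) <= 2 * normc z * ((1 - u) / u).
Proof.
move=> Du; have u0 := D_gt0 Du.
rewrite cpowE ?real_complex_eq0 ?gt_eqF// clog_real//.
have lnu : ln u <= 0 by rewrite ln_le0// ltW// D_lt1.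
have h : Re (z * (ln u)%:C) <= 0.
  by rewrite mulrC cReZ mulr_le0_ge0// ltW.
rewrite (le_trans (cexp_sub1_le h (lexx 0)))// expR0 mulr1 -mulrA ler_pM2l//.
rewrite Normc.normcM ler_wpM2l ?normc_ge0// normc_real ler0_norm//.
rewrite -lnV ?posrE//.
have e : u^-1 = 1 + (1 - u) / u by field; rewrite gt_eqF.
rewrite [in ln _]e.
by rewrite le_ln1Dx// (lt_le_trans (ltrN10 _))// divr_ge0// ltW// D_onem.
Qed.

(** The factor (1 - u)/u turns the kernel of B(n + 2, v) into that of B(n + 1, v + 1). The 4 is 2
    from [cpow_sub1_bound] times 2 from [normc_cintegral]. *)
Let cbeta_diff n : normc (cbeta (z + n.+2%:R) v - cbeta n.+2%:R v) <=
  4 * normc z * normc (cbeta n.+1%:R (v + 1)).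
Proof.
have hn k : 0 < Re (k.+1%:R : C) by rewrite Re_nat.
have i1 : cintegrable D (cbetak (z + n.+2%:R) v).
  by apply: cintegrable_cbetak => //; exact: Re_addn.
have i2 : cintegrable D (cbetak n.+2%:R v) by exact: cintegrable_cbetak.
have iR : mu.-integrable D (EFin \o betak n.+1%:R (v + 1)).
  by apply: integrable_betak; rewrite ?ltr0n// addr_gt0.
have iR' : mu.-integrable D
    (EFin \o (fun u => 2 * normc z * betak n.+1%:R (v + 1) u)).
  by apply: eq_integrable (integrableZl mD (2 * normc z) iR) => // u _ /=.
(* At a natural exponent the kernel is real and nonnegative, so this modulus is the real integral
   itself and no constant is lost. *)
have -> : normc (cbeta n.+1%:R (v + 1)) =
    \int[mu]_(u in D) betak n.+1%:R (v + 1) u.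
  have -> : cbeta n.+1%:R (v + 1) = (\int[mu]_(u in D) betak n.+1%:R (v + 1) u)%:C.
    apply: complexP; rewrite /cbeta /=.
      apply: eq_Rintegral => u; rewrite inE => Du.
      by rewrite Re_cbetak ?(D_gt0 Du)// Im_nat mul0r cos0 mulr1 Re_nat.
    rewrite /Rintegral integral0_eq// => u Du.
    by rewrite Im_cbetak ?(D_gt0 Du)// Im_nat mul0r sin0 mulr0 mul0r.
  by rewrite normc_real ger0_norm// Rintegral_ge0// => u _; exact: betak_ge0.
rewrite /cbeta -cintegralB//.
apply: (le_trans (@normc_cintegral _ _ mD _
  (fun u => 2 * normc z * betak n.+1%:R (v + 1) u) _ _ iR')).
- have := cintegrableD mD i1 (cintegrableZ mD (-1) i2).
  by apply: eq_cintegrable => // u _; rewrite mulN1r.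
- move=> u Du; have u0 := D_gt0 Du; have u1 := D_onem Du.
  have uC0 : u%:C != 0 :> C by rewrite real_complex_eq0 gt_eqF.
  have -> : cbetak (z + n.+2%:R) v u - cbetak n.+2%:R v u =
      (cpow u%:C z - 1) * cbetak n.+2%:R v u.
    by rewrite /cbetak -addrA (cpowD z _ uC0); ring.
  rewrite Normc.normcM normc_cbetak// Re_nat.
  apply: (@le_trans _ _ (2 * normc z * ((1 - u) / u) * betak n.+2%:R v u)).
    by rewrite ler_wpM2r ?betak_ge0// cpow_sub1_bound.
  rewrite -!mulrA ler_pM2l// ler_wpM2l ?normc_ge0//.
  rewrite /betak addrK (powRS v u1) -[n.+2%:R]natr1 addrK (powRS n.+1%:R u0).
  by rewrite le_eqVlt; apply/orP; left; apply/eqP; field; rewrite gt_eqF.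
- rewrite (@RintegralZl _ _ _ mu D _ (2 * normc z) mD iR).
  by rewrite !mulrA -natrM.
Qed.

(** By parts, (n + 1) B(n + 1, v + 1) = v B(n + 2, v), so the difference is O(1/n) relative to B(n +
    2, v). *)
Let cbeta_ratio n : normc (cbeta (z + n.+2%:R) v / cbeta n.+2%:R v - 1) <=
  4 * normc z * v / n.+1%:R.
Proof.
have y0 := cbeta_nat_neq0 n.+1.
have -> : cbeta (z + n.+2%:R) v / cbeta n.+2%:R v - 1 =
  (cbeta (z + n.+2%:R) v - cbeta n.+2%:R v) / cbeta n.+2%:R v.
  by rewrite [RHS]mulrBl divff.
rewrite Normc.normcM Normc.normcV.
rewrite ler_pdivrMr; last by rewrite normc_gt0.
apply: (le_trans (cbeta_diff n)).
have h : 0 < Re (n.+1%:R : C) by rewrite Re_nat.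
have := cbeta_by_parts h v0; rewrite natr1 => /(congr1 (@Normc.normc R)).
move: (cbeta n.+1%:R (v + 1)) (cbeta n.+2%:R v) => s t.
rewrite !Normc.normcM normc_nat normc_real (gtr0_norm v0) => e.
have -> : normc s = v * normc t / n.+1%:R by rewrite -e mulrC mulKf ?pnatr_eq0.
rewrite le_eqVlt; apply/orP; left; apply/eqP; ring.
Qed.

Lemma cbetaE : cbeta z v = Gamma z * Gamma v%:C / Gamma (z + v%:C).
Proof.
have v0' : 0 < Re v%:C by [].
have zv0 : 0 < Re (z + v%:C) by rewrite cReD addr_gt0.
have G w : 0 < Re w -> ((fun n => gauss w n.+1) : nat -> C^o) @ \oo --> (Gamma w : C^o).
  by move=> w0; rewrite (cvg_shiftS (gauss w : nat -> C^o)); exact: cvg_gauss.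
have r1 : ((fun n => cbeta (z + n.+2%:R) v / cbeta n.+2%:R v) : nat -> C^o)
    @ \oo --> (1 : C^o).
  apply: ccvg_norm0; apply: (@squeeze_cvgr _ _ _ _ (fun=> 0)
    (fun n => 4 * normc z * v / n.+1%:R)).
  - by near=> n; rewrite normc_ge0 cbeta_ratio.
  - exact: cvg_cst.
  - rewrite -[X in _ --> X](mulr0 (4 * normc z * v)).
    by apply: cvgMl_tmp; exact: cvg_harmonic.
have h1 := ccvgM (ccvgM (G _ z0) (G _ v0')) r1.
have h2 := ccvgM (G _ zv0) (ccvg_cst (cbeta z v)).
have h3 : ((fun n => gauss (z + v%:C) n.+1 * cbeta z v) : nat -> C^o) @ \oo -->
    (Gamma z * Gamma v%:C * 1 : C^o).
  by apply: eq_seq_cvg h1 => n; exact: gauss_cbeta.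
have := ccvg_unique h3 h2; rewrite mulr1 => ->.
by rewrite mulrC mulKf// Gamma_neq0.
Unshelve. all: by end_near. Qed.

End FixedExponents.

Lemma Gamma1 : Gamma 1 = 1 :> C.
Proof.
have p n : \prod_(i < n) (1 + i%:R) = n`!%:R :> C.
  elim: n => [|n ih]; first by rewrite big_ord0.
  by rewrite big_ord_recr /= ih factS natrM mulrC nat1r.
apply: ccvg_lim; rewrite -(cvg_shiftS (_ : nat -> C^o)).
have h : (fun n : nat => normc ((n.+1`!%:R * cpow n.+1%:R 1 /
    \prod_(i < n.+2) (1 + i%:R) : C) - 1)) @ \oo --> (0 : R).
  (* The term is (n + 1)/(n + 2), off from 1 by a shifted harmonic term. *)
  have := @cvg_harmonic R; rewrite -(cvg_shiftS (@harmonic R)).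
  apply: eq_seq_cvg => n.
  have n0 : n.+1%:R != 0 :> C by rewrite pnatr_eq0.
  have f0 : n.+1`!%:R != 0 :> C by rewrite pnatr_eq0 -leqn0 leqNgt fact_gt0.
  have m0 : n.+2%:R != 0 :> C by rewrite pnatr_eq0.
  rewrite p [n.+2`!]factS natrM (cpowr1 n0) [_.+2%:R * _]mulrC -mulf_div.
  rewrite (divff f0) mul1r.
  have -> : n.+1%:R / n.+2%:R - 1 = - (n.+2%:R)^-1 :> C.
    by apply: (mulIf m0); rewrite mulrBl divfK// mulNr mulVf// mul1r -natr1; ring.
  by rewrite normcN Normc.normcV normc_nat.
exact: ccvg_norm0 h.
Qed.

(** Read off from Beta at v = 1: in z B(z, 2) = B(z + 1, 1) both sides have the denominator Gamma (z
    + 2). The value Gamma 2 = 1 comes from B(1, 1) = 1. *)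
Lemma GammaS z : 0 < Re z -> Gamma (z + 1) = z * Gamma z.
Proof.
move=> z0; have z1 : 0 < Re (z + 1) by rewrite cReD addr_gt0.
have z2 : 0 < Re (z + (1 + 1)%:C) by rewrite cReD addr_gt0 ?addr_gt0.
have e := cbeta_by_parts z0 ltr01.
have o : 0 < Re (1 : C) by exact: ltr01.
have e1 : Gamma ((1 + 1)%:C : C) = 1.
  have := cbetaE o ltr01; rewrite cbeta1// !Gamma1 mulr1 invr1 => /(congr1 GRing.inv).
  by rewrite invr1 mul1r invrK real_complexD => <-.
move: e; rewrite !cbetaE ?addr_gt0// e1 Gamma1 !mulr1 mul1r.
have -> : z + (1 + 1)%:C = z + 1 + 1 by rewrite real_complexD addrA.
rewrite mulrA => /mulIf <- //; rewrite invr_eq0 Gamma_neq0//.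
by rewrite cReD addr_gt0.
Qed.

End BetaGamma.

(** * Fractional integration of series of Mittag-Leffler type *)

Section FractionalSeries.
Context {R : realType}.
Local Notation C := R[i].
Local Notation mu := (@lebesgue_measure R).
Local Notation D := (`](0 : R), 1[%classic : set (measurableTypeR R)).
Implicit Types (z w : C) (e x y u : R).

Let mD : measurable D. Proof. exact: measurable_itv. Qed.

Variables (v P0 : R).
Hypotheses (v0 : 0 < v) (P0_gt : -1 < P0).

Let P1_gt0 : 0 < P0 + 1. Proof. by rewrite -ltrBlDr sub0r. Qed.

Let Ibeta (n : nat) : R := \int[mu]_(u in D) betak (P0 + 1 + v * n%:R) v u.

Let betak_le y y' u : y <= y' -> D u -> betak y' v u <= betak y v u.
Proof.
move=> yy Du; rewrite ler_wpM2r ?powR_ge0// /powR gt_eqF ?(D_gt0 Du)//.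
by rewrite ler_expR ler_wnM2r ?ln_le0 ?lerB// ltW// (D_lt1 Du).
Qed.

Let integrable_Ibeta n : mu.-integrable D (EFin \o betak (P0 + 1 + v * n%:R) v).
Proof. by apply: integrable_betak => //; rewrite ltr_wpDr// mulr_ge0// ltW. Qed.

Let Ibeta_ge0 n : 0 <= Ibeta n.
Proof. by apply: Rintegral_ge0 => u _; exact: betak_ge0. Qed.

(** The kernel is (u^v)^n times the one for n = 0, so it tends to 0 pointwise under a fixed bound.
    This decay takes the place of growth estimates for Gamma. *)
Let cvg_Ibeta : Ibeta @ \oo --> (0 : R).
Proof.
have i0 := integrable_betak P1_gt0 v0.
pose zf : R -> R := cst 0.
have m0 : measurable_fun D (EFin \o zf).
  by apply/measurable_EFinP; exact: measurable_cst.
have mf n : measurable_fun D (EFin \o betak (P0 + 1 + v * n%:R) v).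
  by apply/measurable_EFinP; exact: measurable_betak.
have bound n (u : measurableTypeR R) : D u ->
    (`|(betak (P0 + 1 + v * n%:R) v u)%:E| <= (betak (P0 + 1) v u)%:E)%E.
  move=> Du; rewrite lee_fin ger0_norm ?betak_ge0//.
  by apply: betak_le => //; rewrite lerDl mulr_ge0// ltW.
have cv (u : measurableTypeR R) : D u ->
    (EFin \o betak (P0 + 1 + v * n%:R) v) u @[n --> \oo] --> (EFin \o zf) u.
  move=> Du; have u0 := D_gt0 Du; have u1 := D_lt1 Du.
  apply: cvg_EFin; first by near=> n.
  have : (u `^ v) ^+ n * betak (P0 + 1) v u @[n --> \oo] --> 0 * betak (P0 + 1) v u.
    apply: cvgMr_tmp; apply: cvg_expr; rewrite ger0_norm ?powR_ge0//.
    rewrite /powR gt_eqF// -expR0 ltr_expR pmulr_rlt0// ln_lt0//.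
  rewrite mul0r; apply: eq_seq_cvg => n.
  rewrite /betak mulrA; congr (_ * _).
  rewrite -powR_mulrn ?powR_ge0// -powRrM -powRD; last by rewrite (gt_eqF u0) implybT.
  by congr (_ `^ _); ring.
have [_ _ lim] := @dominated_convergence _ _ _ mu D mD
  (fun n => EFin \o betak (P0 + 1 + v * n%:R) v) (EFin \o zf)
  (EFin \o betak (P0 + 1) v) mf m0 ltac:(by apply: aeW => u Du; exact: cv) i0
  ltac:(by apply: aeW => u n Du; exact: bound).
have lim' : (Ibeta n)%:E @[n --> \oo] --> (0 : R)%:E.
  have -> : (0 : R)%:E = (\int[mu]_(u in D) (EFin \o zf) u)%E.
    by rewrite integral0_eq.
  apply: eq_seq_cvg lim => n; rewrite /Ibeta /Rintegral fineK//.
  by apply: integrable_fin_num => //; exact: integrable_Ibeta.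
exact: (fine_cvg lim').
Unshelve. all: by end_near. Qed.

Let G : C := Gamma v%:C.
Let G_neq0 : G != 0. Proof. exact: Gamma_neq0. Qed.

(* Bounds the coefficients [Gamma w / Gamma (v n + w)] uniformly in [w], since
   the quotient of two consecutive ones is a Beta integral over [Gamma v]. *)
Fixpoint mlQ (n : nat) : R :=
  if n is m.+1 then mlQ m * (2 * Ibeta m / normc G) else 1.

Lemma mlQ_ge0 n : 0 <= mlQ n.
Proof.
elim: n => //= n ih; rewrite mulr_ge0// divr_ge0 ?normc_ge0//.
by rewrite mulr_ge0.
Qed.

Lemma cvg_mlQ x : 0 <= x -> cvgn (series (fun n => mlQ n * x ^+ n)).
Proof.
move=> x0; apply: (@ratio_cvg_series _ _ (fun n => 2 * Ibeta n / normc G * x)).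
- by move=> n; rewrite mulr_ge0 ?mlQ_ge0// exprn_ge0.
- near=> n; rewrite /= exprS le_eqVlt; apply/orP; left; apply/eqP; ring.
- rewrite -[X in _ --> X](mul0r x) -(mul0r (normc G)^-1) -(mulr0 2).
  by apply: cvgMr_tmp; apply: cvgMr_tmp; exact: cvgMl_tmp.
Unshelve. all: by end_near. Qed.

(** Coefficients of Gamma (w) E_{v,w}, normalized to 1 at n = 0. *)
Definition mlq w (n : nat) : C := Gamma w / Gamma (v%:C * n%:R + w).

Let Re_mlarg w n : 0 < Re w -> 0 < Re (v%:C * n%:R + w).
Proof.
by move=> w0; rewrite cReD cReZ Re_nat ltr_wpDl// mulr_ge0// ltW.
Qed.

Lemma mlq0 w : 0 < Re w -> mlq w 0 = 1.
Proof. by move=> w0; rewrite /mlq mulr0 add0r divff// Gamma_neq0. Qed.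

Lemma mlqS w n : 0 < Re w ->
  mlq w n * cbeta (v%:C * n%:R + w) v = G * mlq w n.+1.
Proof.
move=> w0; have h := Re_mlarg n w0; rewrite (cbetaE h v0) /mlq -/G.
have -> : v%:C * n%:R + w + v%:C = v%:C * n.+1%:R + w by rewrite -natr1; ring.
have := Gamma_neq0 h.
move: (Gamma (v%:C * n%:R + w)) (Gamma (v%:C * n.+1%:R + w)) (Gamma w) => g g' g'' g0.
rewrite -[RHS]mulr1 -(divff g0); ring.
Qed.

(** The modulus of u^w depends on Re w only, and lowering Re w to [P0 + 1] enlarges the kernel on
    ]0, 1[. *)
Lemma normc_mlq w n : P0 + 1 <= Re w -> normc (mlq w n) <= mlQ n.
Proof.
move=> wP; have w0 : 0 < Re w by exact: lt_le_trans P1_gt0 wP.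
elim: n => [|n ih]; first by rewrite mlq0// Normc.normc1.
have h := Re_mlarg n w0.
have -> : mlq w n.+1 = mlq w n * cbeta (v%:C * n%:R + w) v / G.
  by rewrite mlqS// mulrC mulKf.
rewrite Normc.normcM Normc.normcV Normc.normcM /= -!mulrA.
apply: ler_pM => //; [exact: normc_ge0|by rewrite divr_ge0 ?normc_ge0|].
rewrite mulrA ler_wpM2r ?invr_ge0 ?normc_ge0//.
apply: (le_trans (normc_cbeta h v0)); rewrite ler_pM2l//.
apply: le_Rintegral => //; [exact: integrable_betak|].
move=> u Du; apply: betak_le => //.
by rewrite cReD cReZ Re_nat addrC lerD2l.
Qed.

Lemma csummable_mlq w Y : P0 + 1 <= Re w ->
  csummable (fun n => mlq w n * Y ^+ n).
Proof.
move=> wP; apply: csummable_dom (cvg_mlQ (normc_ge0 Y)) => n.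
by rewrite Normc.normcM normcX ler_wpM2r ?exprn_ge0 ?normc_ge0 ?normc_mlq.
Qed.

Lemma normc_csum_mlq w Y : P0 + 1 <= Re w ->
  normc (csum (fun n => mlq w n * Y ^+ n)) <=
  limn (series (fun n => mlQ n * normc Y ^+ n)).
Proof.
move=> wP; apply: normc_csum (cvg_mlQ (normc_ge0 Y)) => n.
by rewrite Normc.normcM normcX ler_wpM2r ?exprn_ge0 ?normc_ge0 ?normc_mlq.
Qed.

Variables (K p : nat -> C) (X : C).
Hypotheses (cK : cvgn (series (fun r => normc (K r)))).
Hypothesis (pP : forall r, P0 <= Re (p r)).

Let pP1 r : P0 + 1 <= Re (p r + 1).
Proof. by rewrite cReD lerD2r. Qed.

(** The r-th term at u t, in terms of data at t: [K] will contain t^p_r and [X] will contain t^v, so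
    only the positive real u remains to be integrated. *)
Definition fracterm (r : nat) u : C := K r * cpow u%:C (p r) *
  csum (fun n => mlq (p r + 1) n * (X * (u `^ v)%:C) ^+ n).

Let S := limn (series (fun n => mlQ n * normc X ^+ n)).

Let kernel_term r n u : C := (K r * (mlq (p r + 1) n * X ^+ n)) *
  cbetak (v%:C * n%:R + (p r + 1)) v u.

Let kernel_termE r n u : D u -> kernel_term r n u =
  ((1 - u) `^ (v - 1))%:C * (K r * cpow u%:C (p r)) *
  (mlq (p r + 1) n * (X * (u `^ v)%:C) ^+ n).
Proof.
move=> Du; have u0 := D_gt0 Du.
have uC0 : u%:C != 0 :> C by rewrite real_complex_eq0 gt_eqF.
rewrite /kernel_term /cbetak.
have -> : v%:C * n%:R + (p r + 1) - 1 = p r + v%:C * n%:R by ring.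
by rewrite (cpowD _ _ uC0) (cpowM_nat _ _ uC0) cpow_real// exprMn; ring.
Qed.

Let csum_kernel_term r u : D u -> csum (fun n => kernel_term r n u) =
  ((1 - u) `^ (v - 1))%:C * fracterm r u.
Proof.
move=> Du; rewrite /fracterm mulrA -csumZ; last exact: csummable_mlq.
by apply: eq_csum => n; rewrite kernel_termE.
Qed.

Let Re_arg r n : 0 < Re (v%:C * n%:R + (p r + 1)).
Proof. by apply: Re_mlarg; exact: lt_le_trans P1_gt0 (pP1 r). Qed.

Let cintegrable_kernel_term r n : cintegrable D (kernel_term r n).
Proof. by apply: cintegrableZ => //; exact: cintegrable_cbetak. Qed.

Let cintegral_kernel_term r n : cintegral D (kernel_term r n) =
  G * K r * (mlq (p r + 1) n.+1 * X ^+ n).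
Proof.
rewrite /kernel_term cintegralZ//; last exact: cintegrable_cbetak.
rewrite -/(cbeta _ v).
have w0 : 0 < Re (p r + 1) by exact: lt_le_trans P1_gt0 (pP1 r).
have e := mlqS n w0.
transitivity (K r * X ^+ n * (mlq (p r + 1) n * cbeta (v%:C * n%:R + (p r + 1)) v)).
  ring.
rewrite e; ring.
Qed.

Let bnd r n : R := normc (K r) * (mlQ n * normc X ^+ n).

Let bnd_ge0 r n : 0 <= bnd r n.
Proof. by rewrite mulr_ge0 ?normc_ge0// mulr_ge0 ?mlQ_ge0// exprn_ge0 ?normc_ge0. Qed.

Let series_bnd r : series (bnd r) = (fun n => normc (K r) * series (fun n => mlQ n * normc X ^+ n) n).
Proof. by apply/funext => n; rewrite /series /= mulr_sumr. Qed.

Let cvg_bnd r : series (bnd r) @ \oo --> normc (K r) * S.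
Proof. by rewrite series_bnd; apply: cvgMl_tmp; exact: cvg_mlQ (normc_ge0 X). Qed.

Let kernel_term_le r n u : D u ->
  normc (kernel_term r n u) <= bnd r n * betak (P0 + 1) v u.
Proof.
move=> Du; rewrite Normc.normcM normc_cbetak//.
apply: ler_pM; [exact: normc_ge0|exact: betak_ge0| |].
  rewrite Normc.normcM ler_wpM2l ?normc_ge0// Normc.normcM normcX.
  by rewrite ler_wpM2r ?exprn_ge0 ?normc_ge0 ?normc_mlq.
apply: betak_le => //; rewrite cReD cReZ Re_nat (le_trans (pP1 r))//.
by rewrite lerDr mulr_ge0// ltW.
Qed.

Let mRe_kernel r n : measurable_fun D (fun u => Re (kernel_term r n u)).
Proof. by have [h _] := cintegrable_kernel_term r n; apply/measurable_EFinP; exact: (measurable_int _ h). Qed.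
Let mIm_kernel r n : measurable_fun D (fun u => Im (kernel_term r n u)).
Proof. by have [_ h] := cintegrable_kernel_term r n; apply/measurable_EFinP; exact: (measurable_int _ h). Qed.

Let i0 := integrable_betak P1_gt0 v0.

Let kern r u : C := ((1 - u) `^ (v - 1))%:C * fracterm r u.

Let cintegrable_kern r : cintegrable D (kern r).
Proof.
have := cintegrable_csum mD (mRe_kernel r) (mIm_kernel r) i0
  (cvgP _ (@cvg_bnd r)) (kernel_term_le r) (bnd_ge0 r) (fun u _ => betak_ge0 _ _ u).
by apply: eq_cintegrable => // u Du; exact: csum_kernel_term.
Qed.

Let cvg_cintegral_kern r :
  (series ((fun n => G * K r * (mlq (p r + 1) n.+1 * X ^+ n)) : nat -> C^o) @ \oo -->
    (cintegral D (kern r) : C^o)).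
Proof.
have := cvg_cintegral_csum mD (mRe_kernel r) (mIm_kernel r) i0
  (cvgP _ (@cvg_bnd r)) (kernel_term_le r) (bnd_ge0 r) (fun u _ => betak_ge0 _ _ u).
rewrite (eq_cintegral (@csum_kernel_term r)).
by apply: eq_seq_cvg => n; congr (series _ n); apply/funext => m;
  rewrite cintegral_kernel_term.
Qed.

Definition fracend r : C := csum (fun n => mlq (p r + 1) n * X ^+ n).

Let cintegral_kern r : X * cintegral D (kern r) = G * (K r * fracend r - K r).
Proof.
have c1 := @cvg_cintegral_kern r.
have s1 : csummable (fun n => G * K r * (mlq (p r + 1) n.+1 * X ^+ n)).
  exact: cvg_csummable c1.
rewrite -(csum_unique c1) -csumZ//.
have b : csummable (fun n => mlq (p r + 1) n * X ^+ n) := csummable_mlq (pP1 r).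
have w0 : 0 < Re (p r + 1) by exact: lt_le_trans P1_gt0 (pP1 r).
(* The factor [X] raises X^n to X^(n + 1); what results is G K_r times the series of [fracend r]
   without its term n = 0, which is 1. *)
have -> : csum (fun n => X * (G * K r * (mlq (p r + 1) n.+1 * X ^+ n))) =
  csum (fun n => G * K r * (mlq (p r + 1) n.+1 * X ^+ n.+1)).
  by apply: eq_csum => n; rewrite exprS; ring.
have s2 : csummable (fun n => G * K r * (mlq (p r + 1) n * X ^+ n)).
  exact: cvg_csummable (csummableZ (x := _) b).
have := csum_recl s2; rewrite csumZ// -/(fracend r) mlq0// expr0 !mulr1 => e.
apply/eqP; rewrite mulrBr -subr_eq0 opprB addrA subr_eq0 mulrA e addrC.
by [].
Qed.

Let S_ge0 : 0 <= S.
Proof.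
apply: limr_ge; first exact: cvg_mlQ (normc_ge0 X).
near=> n; rewrite /series /= sumr_ge0// => i _.
by rewrite mulr_ge0 ?mlQ_ge0// exprn_ge0 ?normc_ge0.
Unshelve. all: by end_near. Qed.

Let cvg_KS : cvgn (series (fun r => normc (K r) * S)).
Proof.
have -> : series (fun r => normc (K r) * S) = (fun n => series (fun r => normc (K r)) n * S).
  by apply/funext => n; rewrite /series /= mulr_suml.
exact: is_cvgMr_tmp.
Qed.

(** After summation over n the bound again has product form, with the same kernel in u; this permits
    the second exchange, over r. *)
Let kern_le r u : D u -> normc (kern r u) <= normc (K r) * S * betak (P0 + 1) v u.
Proof.
move=> Du; rewrite /kern -csum_kernel_term//.
have := normc_csum_dom
  (cvgP _ (@cvg_bnd r)) (kernel_term_le r) (bnd_ge0 r) (fun u _ => betak_ge0 _ _ u) Du.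
by rewrite (cvg_lim _ (@cvg_bnd r)).
Qed.

Let mRe_kern r : measurable_fun D (fun u => Re (kern r u)).
Proof. by have [h _] := cintegrable_kern r; apply/measurable_EFinP; exact: (measurable_int _ h). Qed.
Let mIm_kern r : measurable_fun D (fun u => Im (kern r u)).
Proof. by have [_ h] := cintegrable_kern r; apply/measurable_EFinP; exact: (measurable_int _ h). Qed.

Lemma csummable_fracterm u : 0 < u <= 1 -> csummable (fracterm ^~ u).
Proof.
move=> /andP[u0 u1].
apply: (@csummable_dom _ _ (fun r => normc (K r) * S * u `^ P0)).
  move=> r; rewrite /fracterm !Normc.normcM -mulrA [_ * S * _]mulrAC -mulrA.
  rewrite ler_wpM2l ?normc_ge0// normc_cpow_real// ler_pM ?powR_ge0 ?normc_ge0//.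
    by rewrite /powR gt_eqF// ler_expR ler_wnM2r ?ln_le0.
  apply: normc_csum (cvg_mlQ (normc_ge0 X)) => n.
  rewrite Normc.normcM normcX; apply: ler_pM; rewrite ?exprn_ge0 ?normc_ge0 ?normc_mlq//.
  rewrite lerXn2r ?nnegrE ?normc_ge0// Normc.normcM normc_real ger0_norm ?powR_ge0//.
  by rewrite ler_piMr ?normc_ge0// powR_le1// ltW.
have -> : series (fun r => normc (K r) * S * u `^ P0) =
    (fun n => series (fun r => normc (K r) * S) n * u `^ P0).
  by apply/funext => n; rewrite /series /= mulr_suml.
exact: is_cvgMr_tmp.
Qed.

Let csum_kern u : D u -> csum (kern ^~ u) = ((1 - u) `^ (v - 1))%:C * csum (fracterm ^~ u).
Proof.
move=> Du; rewrite /kern csumZ//; apply: csummable_fracterm.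
by rewrite (D_gt0 Du) ltW// (D_lt1 Du).
Qed.

Let KS_ge0 r : 0 <= normc (K r) * S.
Proof. by rewrite mulr_ge0 ?normc_ge0. Qed.

Lemma cintegrable_fracseries :
  cintegrable D (fun u => ((1 - u) `^ (v - 1))%:C * csum (fracterm ^~ u)).
Proof.
have := cintegrable_csum mD mRe_kern mIm_kern i0 cvg_KS kern_le KS_ge0
  (fun u _ => betak_ge0 _ _ u).
by apply: eq_cintegrable => // u Du; exact: csum_kern.
Qed.

Lemma csummable_fracend : csummable (fun r => K r * fracend r).
Proof.
apply: csummable_dom cvg_KS => r; rewrite Normc.normcM.
by rewrite ler_wpM2l ?normc_ge0// normc_csum_mlq.
Qed.

Lemma cintegral_fracseries :
  X * cintegral D (fun u => ((1 - u) `^ (v - 1))%:C * csum (fracterm ^~ u)) =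
  G * (csum (fun r => K r * fracend r) - csum K).
Proof.
have c1 := cvg_cintegral_csum mD mRe_kern mIm_kern i0 cvg_KS kern_le KS_ge0
  (fun u _ => betak_ge0 _ _ u).
rewrite (eq_cintegral csum_kern) in c1.
have sK : csummable K by apply: csummable_dom cK => r.
have s1 : csummable (fun r => cintegral D (kern r)).
  exact: cvg_csummable c1.
have sB : csummable (fun r => K r * fracend r - K r).
  apply: cvg_csummable.
  by apply: eq_seq_cvg (ccvgB (csum_cvg csummable_fracend) (csum_cvg sK)) => n;
    rewrite /series /= -sumrB.
rewrite -(csum_unique c1) -(csumZ X s1) -(csumB csummable_fracend sK) -(csumZ G sB).
by apply: eq_csum => r; exact: cintegral_kern.
Qed.

End FractionalSeries.

(** * Uniqueness for Volterra inequalities *)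

Section AffineChange.
Context {R : realType}.
Local Notation mu := (@lebesgue_measure R).
Local Notation RR := (measurableTypeR R).

(** Lebesgue measure is a times its own image under x -> a x + b: the two agree on half-open
    intervals, which determine the measure. *)
Lemma ge0_integral_affine (a b : R) (f : RR -> \bar R) : 0 < a ->
  measurable_fun [set: RR] f -> (forall x, 0 <= f x)%E ->
  (\int[mu]_x f x = a%:E * \int[mu]_x f (a * x + b)%R)%E.
Proof.
move=> a0 mf f0; pose phi (x : RR) : RR := a * x + b.
have mphi : measurable_fun [set: RR] phi.
  apply: measurable_funD; last exact: measurable_cst.
  apply: measurable_funM; [exact: measurable_cst|exact: measurable_id].
pose k : {nonneg R} := NngNum (ltW a0).
pose pm : {measure set RR -> \bar R} :=
  measure_function_pushforward__canonical__measure_function_Measure mu mphi.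
pose nu : {measure set RR -> \bar R} := mscale k pm.
have nuE (A : set RR) : measurable A -> mu A = nu A.
  apply: lebesgue_measure_unique => _ [[x y] _ <-] /=.
  rewrite /nu /mscale /= /pushforward.
  have -> : phi @^-1` `]x, y] = `](x - b) / a, (y - b) / a]%classic.
    apply/seteqP; split => u; rewrite /phi /= !in_itv/= => /andP[h1 h2].
      by rewrite ltr_pdivrMr// ler_pdivlMr//; apply/andP; split; lra.
    move: h1 h2; rewrite ltr_pdivrMr// ler_pdivlMr// => h1 h2.
    by apply/andP; split; lra.
  rewrite !lebesgue_measure_itv/= !lte_fin ltr_pM2r ?invr_gt0// ltrD2r.
  case: ifP => _; last by rewrite mule0.
  by rewrite -!EFinD -EFinM; congr EFin; field; rewrite gt_eqF.
rewrite (@eq_measure_integral _ _ _ _ nu); last by move=> A mA _; exact: nuE.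
rewrite ge0_integral_mscale//; congr (_ * _)%E.
by rewrite (ge0_integral_pushforward mphi).
Qed.
End AffineChange.

Section Volterra.
Context {R : realType}.
Local Notation mu := (@lebesgue_measure R).
Local Notation RR := (measurableTypeR R).
Implicit Types (s w x u : R).

Local Notation itv0 s := (`](0%R : R), s[%classic : set RR).

Variable v : R.
Hypothesis v0 : 0 < v.

(** Extended by 0 so that [ker (s - w)] also encodes w < s, and the Volterra integral becomes a
    convolution over the line. *)
Let ker x : R := if 0 < x then x `^ (v - 1) else 0.

Let ker_ge0 x : 0 <= ker x.
Proof. by rewrite /ker; case: ifP => // _; exact: powR_ge0. Qed.

Let measurable_ker : measurable_fun [set: RR] ker.
Proof.
apply: measurable_fun_if => //.
- by apply: measurable_fun_ltr; [exact: measurable_cst|exact: measurable_id].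
- by apply: measurable_funTS; exact: measurable_powR.
Qed.

Let expker (n : nat) x : R := expR (- (n%:R * x)) * ker x.

Let expker_ge0 n x : 0 <= expker n x.
Proof. by rewrite mulr_ge0 ?expR_ge0. Qed.

Let measurable_expl n : measurable_fun [set: RR] (fun x : R => expR (- (n%:R * x))).
Proof.
by apply: measurableT_comp => //; apply: measurableT_comp.
Qed.

Let measurable_expker n : measurable_fun [set: RR] (expker n).
Proof. exact: measurable_funM. Qed.

Local Notation D := (`](0 : R), 1[%classic : set RR).

Let mD : measurable D. Proof. exact: measurable_itv. Qed.

(** This integral will be the contraction factor. The range ]0, 1[ is enough because differences of
    points of ]0, h[ stay below 1. *)
Let cvg_expker : \int[mu]_(x in D) expker n x @[n --> \oo] --> (0 : R).
Proof.
have i0 := integrable_powR v0.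
pose zf : R -> R := cst 0.
pose pw : R -> R := fun x => x `^ (v - 1).
have mz : measurable_fun D (EFin \o zf).
  by apply/measurable_EFinP; exact: measurable_cst.
have mf n : measurable_fun D (EFin \o expker n).
  by apply/measurable_EFinP; apply: measurable_funTS.
have kE x : D x -> ker x = x `^ (v - 1) by move=> /D_gt0 x0; rewrite /ker x0.
have bound n (x : RR) : D x ->
    (`|(EFin \o expker n) x| <= (EFin \o pw) x)%E.
  move=> Dx; rewrite lee_fin ger0_norm ?expker_ge0// /expker kE//.
  rewrite ler_piMl ?powR_ge0// -expR0 ler_expR oppr_le0 mulr_ge0//.
  exact: ltW (D_gt0 Dx).
have cv (x : RR) : D x -> (EFin \o expker n) x @[n --> \oo] --> (EFin \o zf) x.
  move=> Dx; apply: cvg_EFin; first by near=> n.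
  have : expR (- x) ^+ n * ker x @[n --> \oo] --> 0 * ker x.
    apply: cvgMr_tmp; apply: cvg_expr; rewrite ger0_norm ?expR_ge0//.
    by rewrite -expR0 ltr_expR oppr_lt0 (D_gt0 Dx).
  rewrite mul0r; apply: eq_seq_cvg => n.
  by rewrite /expker -expRM_natl mulrN.
have [_ _ lim] := @dominated_convergence _ _ _ mu D mD
  (fun n => EFin \o expker n) (EFin \o zf)
  (EFin \o pw) mf mz ltac:(by apply: aeW => u Du; exact: cv) i0
  ltac:(by apply: aeW => u n Du; exact: bound).
have lim' : (\int[mu]_(x in D) expker n x)%:E @[n --> \oo] --> (0 : R)%:E.
  have -> : (0 : R)%:E = (\int[mu]_(u in D) (EFin \o zf) u)%E.
    by rewrite integral0_eq.
  apply: eq_seq_cvg lim => n; rewrite /Rintegral fineK//.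
  apply: integrable_fin_num => //.
  apply: (@le_integrable _ _ _ mu D mD _ (EFin \o pw) _ _ i0); first exact: (mf n).
  move=> x Dx; apply: (le_trans (bound n x Dx)).
  by rewrite /= lee_fin ler_norm.
exact: (fine_cvg lim').
Unshelve. all: by end_near. Qed.

Let expker_int n :
  (\int[mu]_(x in D) (expker n x)%:E = (\int[mu]_(x in D) expker n x)%:E)%E.
Proof.
rewrite /Rintegral fineK//; apply: integrable_fin_num => //.
apply: (le_integrable mD _ _ (integrable_powR v0)).
  by apply/measurable_EFinP; apply: measurable_funTS.
move=> x Dx /=; rewrite lee_fin !ger0_norm ?powR_ge0 ?expker_ge0//.
rewrite /expker /ker (D_gt0 Dx) ler_piMl ?powR_ge0// -expR0 ler_expR oppr_le0.
by rewrite mulr_ge0// ltW// (D_gt0 Dx).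
Qed.

(* The weight [expR (- n s)] makes the integral operator a contraction of the
   weighted L1 space on ]0, h[ for large [n], hence [nu = 0] almost everywhere. *)
Lemma volterra_eq0 (nu : R -> R) (C h : R) : 0 < h <= 1 -> 0 <= C ->
  (forall s, 0 <= nu s) ->
  measurable_fun (itv0 h) nu ->
  (\int[mu]_(s in (itv0 h)) (nu s)%:E < +oo)%E ->
  (forall s : R, 0 < s <= h -> ((nu s)%:E <= C%:E *
    \int[mu]_(w in (itv0 s)) ((s - w) `^ (v - 1) * nu w)%R%:E)%E) ->
  nu h = 0.
Proof.
move=> /andP[h0 h1] C0 nu0 mnu nuoo nule.
pose H := itv0 h.
have mH : measurable H by exact: measurable_itv.
pose nut : R -> R := nu \_ H.
have mnut : measurable_fun [set: RR] nut.
  by apply/(measurable_restrictT _ _).1.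
have nut0 w : 0 <= nut w by rewrite /nut patchE; case: ifP.
pose one : RR -> R := \1_H.
have mone : measurable_fun [set: RR] one by exact: measurable_indic.
have one0 s : 0 <= one s by rewrite /one indicE.
have oneH s : H s -> one s = 1 by move=> Hs; rewrite /one indicE mem_set.
have nutH s : H s -> nut s = nu s by move=> Hs; rewrite /nut patchE mem_set.
have nutNH s : ~ H s -> nut s = 0 by move=> Hs; rewrite /nut patchE memNset.
have [n nC] : exists n, C * \int[mu]_(x in D) expker n x <= 2^-1.
  have : C * \int[mu]_(x in D) expker n x @[n --> \oo] --> C * 0.
    exact: cvgMl_tmp.
  rewrite mulr0 => /cvgrPdist_le/(_ 2^-1 ltac:(by rewrite invr_gt0))[n _ hn].
  exists n; have := hn n (leqnn n); rewrite sub0r normrN; apply: le_trans.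
  exact: ler_norm.
pose e s := expR (- (n%:R * s)).
have me : measurable_fun [set: RR] e by exact: measurable_expl.
pose g (sw : RR * RR) : \bar R := (one sw.1 * e sw.1 * ker (sw.1 - sw.2) * nut sw.2)%:E.
have g0 sw : (0 <= g sw)%E.
  by rewrite lee_fin !mulr_ge0 ?expR_ge0// /one indicE.
have mg : measurable_fun [set: RR * RR] g.
  apply/measurable_EFinP; apply: measurable_funM; last first.
    by apply: measurableT_comp => //; exact: measurable_snd.
  apply: measurable_funM; last first.
    apply: measurableT_comp => //; apply: measurable_funB.
      exact: measurable_fst.
    exact: measurable_snd.
  apply: (@measurableT_comp _ _ _ _ _ _ (fun s => one s * e s)); last exact: measurable_fst.
  exact: measurable_funM.
have kerE s : 0 < s <= h ->
    (\int[mu]_(w in itv0 s) ((s - w) `^ (v - 1) * nu w)%R%:E =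
     \int[mu]_w (ker (s - w) * nut w)%R%:E)%E.
  move=> /andP[s0 sh]; rewrite integral_mkcond; apply: eq_integral => w _.
  rewrite patchE; case: ifPn => [|/negP].
    rewrite inE /= in_itv/= => /andP[w0 ws].
    by rewrite /ker subr_gt0 ws nutH//= /H /= in_itv/= w0 (lt_le_trans ws).
  rewrite inE /= in_itv/= => ns; rewrite /ker subr_gt0.
  have [ws|ws] := ltP w s; last by rewrite mul0r.
  rewrite nutNH ?mulr0// /H /= in_itv/= => /andP[w0 _].
  by apply: ns; rewrite w0.
have mkn s : measurable_fun [set: RR] (fun w => (ker (s - w) * nut w)%:E).
  apply/measurable_EFinP; apply: measurable_funM => //.
  by apply: measurableT_comp => //; apply: measurable_funB.
pose f s := one s * e s * nut s.
have f0 s : 0 <= f s by rewrite !mulr_ge0 ?expR_ge0.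
have mf : measurable_fun [set: RR] f.
  by apply: measurable_funM => //; exact: measurable_funM.
pose Phi := (\int[mu]_s (f s)%:E)%E.
have Phi_ge0 : (0 <= Phi)%E by apply: integral_ge0 => s _; rewrite lee_fin.
(* Finiteness is what lets Phi <= Phi / 2 force Phi = 0. *)
have Phi_fin : (Phi < +oo)%E.
  apply: le_lt_trans nuoo; rewrite [leRHS]integral_mkcond.
  apply: ge0_le_integral => //.
  - by move=> s _; rewrite lee_fin.
  - exact/measurable_EFinP.
  - by apply/(measurable_restrictT _ _).1 => //; exact/measurable_EFinP.
  - move=> s _; rewrite patchE; case: ifPn => [|/negP]; rewrite inE => Hs.
      rewrite lee_fin /f oneH// mul1r nutH// ler_piMl// /e -expR0 ler_expR.
      rewrite oppr_le0 mulr_ge0//; move: Hs; rewrite /H /= in_itv/=.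
      by move=> /andP[/ltW].
    by rewrite lee_fin /f nutNH// mulr0.
have gE s w : g (s, w) = ((one s * e s)%:E * (ker (s - w) * nut w)%:E)%E.
  by rewrite /g /= -EFinM; congr EFin; ring.
have step1 : (Phi <= C%:E * \int[mu]_s \int[mu]_w g (s, w))%E.
  have mF := @measurable_fun_fubini_tonelli_F _ _ RR RR R mu g mg g0.
  rewrite -ge0_integralZl//; last first.
    by move=> s _; apply: integral_ge0.
  apply: ge0_le_integral => //.
  - by move=> s _; rewrite lee_fin.
  - exact/measurable_EFinP.
  - exact: measurable_funeM.
  - move=> s _; have [Hs|Hs] := pselect (H s); last first.
      rewrite /f nutNH// mulr0 mule_ge0// ?lee_fin//.
      by apply: integral_ge0.
    under eq_integral do rewrite gE.
    rewrite ge0_integralZl//; last 2 first.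
    + by move=> w _; rewrite lee_fin mulr_ge0.
    + by rewrite lee_fin mulr_ge0 ?expR_ge0.
    have sh : 0 < s <= h.
      by move: Hs; rewrite /H /= in_itv/= => /andP[-> /ltW ->].
    rewrite /f EFinM muleCA lee_wpmul2l//; first by rewrite lee_fin mulr_ge0 ?expR_ge0.
    by rewrite nutH// -kerE// nule.
(* The weight factors as e s = exp (- n (s - w)) e w, and 0 < s - w < 1 for w < s in ]0, h[;
   integrating in s first leaves the contraction factor times f w. *)
have step2 w : (\int[mu]_s g (s, w) <= (\int[mu]_(x in D) expker n x)%:E * (f w)%:E)%E.
  have [Hw|Hw] := pselect (H w); last first.
    rewrite integral0_eq; first by rewrite /f (nutNH w Hw) mulr0 mule0.
    by move=> s _; rewrite /g /= (nutNH w Hw) mulr0.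
  pose F x : \bar R := (((expker n) \_ D) x)%:E.
  have mF : measurable_fun [set: RR] F.
    apply/measurable_EFinP; apply/(measurable_restrictT _ _).1 => //.
    exact: measurable_funTS.
  have F0 x : (0 <= F x)%E by rewrite lee_fin patchE; case: ifP.
  have -> : ((\int[mu]_(x in D) expker n x)%:E = \int[mu]_s F (s - w)%R)%E.
    have /(_ _ F ltr01 mF F0) := @ge0_integral_affine R 1.
    move=> /(_ (- w)); rewrite mul1e => e1.
    transitivity (\int[mu]_x F x)%E.
      rewrite -expker_int integral_mkcond; apply: eq_integral => x _.
      by rewrite /F !patchE; case: ifP.
    by rewrite e1; apply: eq_integral => x _; rewrite mul1r.
  have mFw : measurable_fun [set: RR] (fun s => F (s - w)%R).
    by apply: measurableT_comp => //; apply: measurable_funB.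
  rewrite -ge0_integralZr//; last by rewrite lee_fin.
  apply: ge0_le_integral => //.
  - have mkw : measurable_fun [set: RR] (fun s => ker (s - w)).
      by apply: measurableT_comp => //; apply: measurable_funB.
    have mgw : measurable_fun [set: RR] (fun s => one s * e s * ker (s - w) * nut w).
      by do 3 apply: measurable_funM => //.
    exact/measurable_EFinP.
  - by apply: emeasurable_funM.
  - move=> s _; rewrite /F /f (oneH w Hw) mul1r -EFinM lee_fin /g /= !mulrA.
    rewrite ler_wpM2r//.
    have [Hs|Hs] := pselect (H s); last first.
      rewrite /one indicE memNset// !mul0r mulr_ge0 ?expR_ge0// patchE.
      by case: ifP.
    rewrite oneH// mul1r patchE.
    move: Hs Hw; rewrite /H /= !in_itv/= => /andP[s0 sh] /andP[w0 wh].
    case: ifPn => [_|/negP].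
      have es : e s = expR (- (n%:R * (s - w))) * e w.
        by rewrite /e -expRD; congr expR; ring.
      by rewrite /expker es le_eqVlt; apply/orP; left; apply/eqP; ring.
    rewrite inE /= in_itv/= => ns; rewrite /ker subr_gt0.
    have [ws|ws] := ltP w s; last by rewrite mulr0 mul0r.
    exfalso; apply: ns; rewrite subr_gt0 ws/=; lra.
have step3 : (Phi <= (2^-1)%:E * Phi)%E.
  apply: (le_trans step1); rewrite (@fubini_tonelli _ _ RR RR R mu mu g mg g0).
  apply: (@le_trans _ _ (C%:E * ((\int[mu]_(x in D) expker n x)%:E * Phi)))%E.
    rewrite lee_wpmul2l ?lee_fin// /Phi -ge0_integralZl//; last 3 first.
    - exact/measurable_EFinP.
    - by move=> s _; rewrite lee_fin.
    - by rewrite lee_fin Rintegral_ge0.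
    apply: ge0_le_integral => //.
    - by move=> w _; apply: integral_ge0.
    - exact: (@measurable_fun_fubini_tonelli_G _ _ RR RR R mu g mg g0).
    - by apply: measurable_funeM; exact/measurable_EFinP.
  by rewrite muleA -EFinM lee_wpmul2r// lee_fin.
have Phi0 : Phi = 0%E.
  clear step1; move: step3 Phi_ge0 Phi_fin; case: Phi => [r||]//.
  rewrite -EFinM !lee_fin => r1 r2 _; congr EFin; lra.
have fae : ae_eq mu setT (fun s => (f s)%:E) (cst 0%E).
  apply/ae_eq_integral_abs => //; first exact/measurable_EFinP.
  rewrite -[RHS]Phi0; apply: eq_integral => s _.
  by rewrite gee0_abs ?lee_fin.
(* So far [nu] vanishes only almost everywhere on ]0, h[, and h lies outside. The inequality at s =
   h bounds [nu h] by the integral of a function that is 0 almost everywhere. *)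
apply/eqP; rewrite eq_le nu0 andbT -lee_fin.
apply: (le_trans (nule h _)); first by rewrite h0 lexx.
rewrite kerE ?h0 ?lexx//.
rewrite (@ge0_ae_eq_integral _ _ _ mu setT _ (cst 0%E))//.
- by rewrite integral0 mule0.
- by move=> w _; rewrite lee_fin mulr_ge0.
apply: filterS fae => w /(_ I) /= [] fw _.
have [Hw|Hw] := pselect (H w); last by rewrite nutNH// mulr0.
move: fw; rewrite /f oneH// mul1r => /eqP; rewrite mulf_eq0 gt_eqF ?expR_gt0//=.
by move=> /eqP ->; rewrite mulr0.
Qed.

End Volterra.

(** * Riemann-Liouville integrals along a ray *)

Section RiemannLiouville.
Context {R : realType}.
Local Notation C := R[i].
Local Notation mu := (@lebesgue_measure R).
Local Notation RR := (measurableTypeR R).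
Local Notation D := (`](0 : R), 1[%classic : set RR).
Local Notation itv0 s := (`](0%R : R), s[%classic : set RR).
Implicit Types (f : C -> C) (t : C) (s u w : R).

Let mD : measurable D. Proof. exact: measurable_itv. Qed.

Variable v : R.
Hypothesis v0 : 0 < v.

Definition RL_kernel f t u : C := ((1 - u) `^ (v - 1))%:C * f (u%:C * t).

Lemma RL_integrandE f t u : t != 0 -> D u ->
  RL_integrand v%:C f t u = cpow t v%:C * RL_kernel f t u.
Proof.
move=> t0 Du; have u1 := D_onem Du; rewrite /RL_integrand.
have -> : t - u%:C * t = (1 - u)%:C * t by rewrite real_complexB; ring.
have e : v%:C - 1 = (v - 1)%:C :> C by rewrite real_complexB.
rewrite e cpowM_real// cpow_real// -e -{3}(cpowr1 t0).
have -> : cpow t v%:C = cpow t (v%:C - 1) * cpow t 1 by rewrite -cpowD// subrK.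
by rewrite /RL_kernel; ring.
Qed.

Lemma RL_definedP f t : t != 0 ->
  RL_defined v%:C f t <-> cintegrable D (RL_kernel f t).
Proof.
move=> t0; have c0 : cpow t v%:C != 0 by exact: cpow_neq0.
split=> [/cintegrable_itvcc h|h].
  have := cintegrableZ mD (cpow t v%:C)^-1 h.
  by apply: eq_cintegrable => // u Du; rewrite RL_integrandE// mulKf.
apply/cintegrable_itvcc; have := cintegrableZ mD (cpow t v%:C) h.
by apply: eq_cintegrable => // u Du; rewrite RL_integrandE.
Qed.

Lemma RL_integralE f t : t != 0 -> cintegrable D (RL_kernel f t) ->
  RL_integral v%:C f t =
  (Gamma v%:C)^-1 * (cpow t v%:C * cintegral D (RL_kernel f t)).
Proof.
move=> t0 h; have h' : cintegrable D (RL_integrand v%:C f t).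
  have := cintegrableZ mD (cpow t v%:C) h.
  by apply: eq_cintegrable => // u Du; rewrite RL_integrandE.
rewrite /RL_integral (cintegral_itvcc h') -cintegralZ//.
by congr (_ * _); apply: eq_cintegral => u Du; exact: RL_integrandE.
Qed.

Section Uniqueness.
Variables (M : C -> C) (t : C) (c : C).
Hypothesis t0 : t != 0.
Hypothesis Mi : forall s, 0 < s <= 1 -> cintegrable D (RL_kernel M (s%:C * t)).
Hypothesis Meq : forall s, 0 < s <= 1 ->
  M (s%:C * t) = c * (cpow (s%:C * t) v%:C * cintegral D (RL_kernel M (s%:C * t))).

Let m s : C := M (s%:C * t).
(** Equivalent to the modulus up to a factor 2, and preferred to it because integrability is
    immediate from that of the two parts. *)
Let nu s : R := `|Re (m s)| + `|Im (m s)|.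

Let nu_ge0 s : 0 <= nu s. Proof. by rewrite addr_ge0. Qed.

Let kernelE s u : RL_kernel M (s%:C * t) u = ((1 - u) `^ (v - 1))%:C * m (s * u).
Proof. by rewrite /RL_kernel /m real_complexM mulrA [u%:C * _]mulrC. Qed.

Let nui s : 0 < s <= 1 ->
  mu.-integrable D (EFin \o (fun u => (1 - u) `^ (v - 1) * nu (s * u))).
Proof.
move=> s01; have [iR iI] := Mi s01.
apply: eq_integrable (integrableD mD (integrable_abse iR) (integrable_abse iI)) => // u.
rewrite inE => Du /=; rewrite kernelE cReZ cImZ !normrM -EFinD -mulrDr.
by rewrite ger0_norm ?powR_ge0.
Qed.

(** The 4 is 2 for passing from [nu] to the modulus times 2 from [normc_cintegral]. *)
Let m_le s : 0 < s <= 1 -> nu s <= 4 * normc c * normc (cpow t v%:C) *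
  (s `^ v * \int[mu]_(u in D) ((1 - u) `^ (v - 1) * nu (s * u))).
Proof.
move=> s01; have s0 : 0 < s by case/andP: s01.
have h : normc (cintegral D (RL_kernel M (s%:C * t))) <=
    2 * \int[mu]_(u in D) ((1 - u) `^ (v - 1) * nu (s * u)).
  apply: normc_cintegral => //; [exact: Mi|move=> u Du|exact: nui].
  rewrite kernelE Normc.normcM normc_real ger0_norm ?powR_ge0//.
  by rewrite ler_wpM2l ?powR_ge0// ler_normc_ReIm.
have nm : nu s <= 2 * normc (m s).
  by rewrite mulr_natl mulr2n lerD ?ler_Re_normc ?ler_Im_normc.
apply: (le_trans nm); rewrite /m Meq// !Normc.normcM cpowM_real// Normc.normcM.
rewrite normc_cpow_real// [Re v%:C]/=.
move: h; set I := \int[mu]_(_ in D) _; set J := normc (cintegral _ _) => h.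
have k0 : 0 <= 2 * normc c * normc (cpow t v%:C) * s `^ v.
  by rewrite !mulr_ge0 ?normc_ge0 ?powR_ge0.
have := ler_wpM2l k0 h; rewrite -subr_ge0 => h2; rewrite -subr_ge0.
by apply: (le_trans h2); rewrite le_eqVlt; apply/orP; left; apply/eqP; ring.
Qed.

(** Measurability of M along the ray is recovered from that of the kernel at s = 1, by dividing out
    the positive weight (1 - u)^(v - 1). *)
Let mnu : measurable_fun D nu.
Proof.
have s1 : 0 < (1 : R) <= 1 by rewrite ltr01 lexx.
have [iR iI] := Mi s1.
have mR : measurable_fun D (fun u => Re (RL_kernel M (1%:C * t) u)).
  by apply/measurable_EFinP; exact: (measurable_int _ iR).
have mI : measurable_fun D (fun u => Im (RL_kernel M (1%:C * t) u)).
  by apply/measurable_EFinP; exact: (measurable_int _ iI).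
have mp : measurable_fun D (fun u => (1 - u) `^ (1 - v)).
  by apply: measurable_funTS; have := @measurable_onem_powR R (1 - v).
have pK u : D u -> (1 - u) `^ (1 - v) * (1 - u) `^ (v - 1) = 1.
  move=> /D_onem u1; rewrite -powRD; last by rewrite (gt_eqF u1) implybT.
  by rewrite addrA subrK subrr powRr0.
have mRm : measurable_fun D (fun u => Re (m u)).
  apply: (eq_measurable_fun _ _ (measurable_funM mp mR)) => u.
  by rewrite inE => Du /=; rewrite kernelE cReZ mulrA pK// !mul1r.
have mIm : measurable_fun D (fun u => Im (m u)).
  apply: (eq_measurable_fun _ _ (measurable_funM mp mI)) => u.
  by rewrite inE => Du /=; rewrite kernelE cImZ mulrA pK// !mul1r.
by apply: measurable_funD; apply: measurableT_comp.
Qed.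

Let itv0_sub s : s <= 1 -> itv0 s `<=` D.
Proof.
move=> s1 x; rewrite /= !in_itv/= => /andP[-> xs].
by rewrite (lt_le_trans xs).
Qed.

(** Substitution w = s u: of s^v = s s^(v - 1), the first factor is the Jacobian and the second
    turns (1 - u)^(v - 1) into (s - w)^(v - 1). *)
Let affine s : 0 < s <= 1 ->
  ((s `^ v * \int[mu]_(u in D) ((1 - u) `^ (v - 1) * nu (s * u)))%R%:E =
  \int[mu]_(w in itv0 s) ((s - w) `^ (v - 1) * nu w)%R%:E)%E.
Proof.
move=> s01; have /andP[s0 s1] := s01.
pose F (w : RR) : \bar R :=
  (((fun w => (s - w) `^ (v - 1) * nu w)%R \_ (itv0 s)) w)%:E.
have F0 w : (0 <= F w)%E.
  by rewrite lee_fin patchE; case: ifP => // _; rewrite mulr_ge0 ?powR_ge0.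
have mF : measurable_fun [set: RR] F.
  apply/measurable_EFinP; apply/(measurable_restrictT _ _).1 => //.
  apply: measurable_funM; last exact: measurable_funS (itv0_sub s1) mnu.
  have h1 : measurable_fun [set: RR] (@powR R ^~ (v - 1)) by exact: measurable_powR.
  have h2 : measurable_fun [set: RR] (fun w : R => s - w) by exact: measurable_funB.
  by apply: measurable_funTS; exact: (measurableT_comp h1 h2).
transitivity (\int[mu]_w F w)%E; last first.
  rewrite [RHS]integral_mkcond; apply: eq_integral => w _.
  by rewrite /F !patchE; case: ifP.
rewrite (ge0_integral_affine 0 s0 mF F0).
rewrite (powRS v s0) -mulrA EFinM; congr (_ * _)%E.
rewrite -RintegralZl//; last exact: nui.
rewrite /Rintegral fineK; last first.
  apply: integrable_fin_num => //.
  by apply: eq_integrable (integrableZl mD (s `^ (v - 1)) (nui s01)) => // u _ /=.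
rewrite integral_mkcond; apply: eq_integral => u _.
rewrite /F addr0 !patchE.
have -> : (s * u \in itv0 s) = (u \in D).
  apply/idP/idP; rewrite !inE /= !in_itv/= pmulr_rgt0// -{2}[s]mulr1 ltr_pM2l//.
case: ifPn => // /[!inE] Du.
have -> : s - s * u = s * (1 - u) by ring.
by rewrite powRM ?(ltW s0) ?(ltW (D_onem Du))// mulrA.
Qed.

(** Only the midpoint is claimed: the weight (1 - u)^(v - 1) is bounded away from 0 on ]0, 1/2[,
    which makes [nu] integrable there, but for v > 1 it vanishes at u = 1. *)
Lemma homogeneous_eq0 : M ((2^-1)%:C * t) = 0.
Proof.
have h01 : 0 < (2^-1 : R) <= 1 by rewrite invr_gt0 ltr0n/= invf_le1// ler1n.
have nu0 : nu 2^-1 = 0.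
  apply: (@volterra_eq0 _ _ v0 nu (4 * normc c * normc (cpow t v%:C))) => //.
  - by rewrite !mulr_ge0 ?normc_ge0.
  - apply: measurable_funS mnu => //; apply: itv0_sub; by case/andP: h01.
  - have s1 : 0 < (1 : R) <= 1 by rewrite ltr01 lexx.
    (* [Kb] is 2^|1 - v|, a bound for (1 - u)^(1 - v) on ]0, 1/2[. *)
    pose Kb := expR (`|1 - v| * ln 2) : R.
    have nuK u : itv0 2^-1 u -> nu u <= Kb * ((1 - u) `^ (v - 1) * nu (1 * u)).
      move=> Hu; have Du : D u by apply: itv0_sub Hu; case/andP: h01.
      have u1 := D_onem Du; rewrite mul1r mulrA ler_peMl//.
      apply: (@le_trans _ _ ((1 - u) `^ (1 - v) * (1 - u) `^ (v - 1))).
        rewrite -powRD; last by rewrite (gt_eqF u1) implybT.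
        by rewrite addrA subrK subrr powRr0.
      rewrite ler_wpM2r ?powR_ge0// /powR gt_eqF// ler_expR.
      rewrite (le_trans (ler_norm _))// normrM ler_wpM2l//.
      rewrite ler0_norm; last by rewrite ln_le0// lerBlDr lerDl ltW// (D_gt0 Du).
      rewrite -lnV ?posrE// ler_ln ?posrE ?invr_gt0//.
      rewrite -[2]invrK lef_pV2 ?posrE ?invr_gt0//.
      by move: Hu; rewrite /= in_itv/= => /andP[_ /ltW]; lra.
    have iK : mu.-integrable (itv0 2^-1)
        (EFin \o (fun u => Kb * ((1 - u) `^ (v - 1) * nu (1 * u)))).
      have iD : mu.-integrable D
          (EFin \o (fun u => Kb * ((1 - u) `^ (v - 1) * nu (1 * u)))).
        by apply: eq_integrable (integrableZl mD Kb (nui s1)) => // u _ /=.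
      apply: (integrableS _ _ _ iD) => //; apply: itv0_sub; by case/andP: h01.
    apply: le_lt_trans (integrable_lty _ iK) => //.
    apply: ge0_le_integral => //.
    + by move=> u _; rewrite lee_fin.
    + apply/measurable_EFinP; apply: measurable_funS mnu => //.
      by apply: itv0_sub; case/andP: h01.
    + exact: (measurable_int _ iK).
  - move=> s /andP[s0 sh]; have s01 : 0 < s <= 1.
      by rewrite s0 (le_trans sh)//; case/andP: h01.
    by rewrite -affine// -EFinM lee_fin m_le.
move/eqP: nu0; rewrite paddr_eq0// !normr_eq0 => /andP[/eqP hR /eqP hI].
exact: complexP.
Qed.

End Uniqueness.
End RiemannLiouville.

(** * The kinetic equation *)

Section KineticEquation.
Context {R : realType}.
Local Notation C := R[i].
Local Notation RR := (measurableTypeR R).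
Local Notation D := (`](0 : R), 1[%classic : set RR).

Let mD : measurable D. Proof. exact: measurable_itv. Qed.

Variables (k d v : R) (a c l N0 : C).
Hypotheses (k_gt0 : 0 < k) (d_gt0 : 0 < d) (v_gt0 : 0 < v).
Hypothesis l_int : -1 < v * (Re l / k + 1).

Let kC0 : k%:C != 0 :> C. Proof. by rewrite real_complex_eq0 gt_eqF. Qed.

Definition kexp (r : nat) : C := v%:C * (2 * r%:R + l / k%:C + 1).

(* For small [r] the real part of [r + l / k + 3 / 2] may be negative; the value
   of [kGamma] there is irrelevant, as it occurs in both series. *)
Definition kcoef (r : nat) : C :=
  (- c) ^+ r / (kGamma k (r%:R * k%:C + l + 3 / 2 * k%:C) * Gamma (r%:R + 3 / 2))
  * cpow ((d `^ v)%:C / 2) (2 * r%:R + l / k%:C + 1).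

Definition kmono (t : C) (r : nat) : C := kcoef r * cpow t (kexp r).

Definition karg (t : C) : C := - cpow a v%:C * cpow t v%:C.

Let dv_gt0 : 0 < d `^ v. Proof. exact: powR_gt0. Qed.

Let half_dv : (d `^ v)%:C / 2 = (d `^ v / 2)%:C :> C.
Proof. by rewrite real_complexM real_complexV real_complex_nat. Qed.

Let half_dv0 : (d `^ v)%:C / 2 != 0 :> C.
Proof. by rewrite half_dv real_complex_eq0 gt_eqF// divr_gt0. Qed.

Let P0 := v * (Re l / k + 1).

Let Re_lk : Re (l / k%:C) = Re l / k.
Proof. by rewrite -real_complexV mulrC cReZ mulrC. Qed.

Let Re_kexp r : P0 <= Re (kexp r).
Proof.
rewrite /kexp /P0 cReZ (ler_wpM2l (ltW v_gt0))// !cReD Re_lk -natrM Re_nat /=.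
by rewrite lerD2r lerDr.
Qed.

(** The one place where the branch condition on t acts: (t^v)^w becomes t^(v w). *)
Lemma kStruveE t : principal_domain v t ->
  kStruve k l c ((d `^ v)%:C * cpow t v%:C) = csum (kmono t).
Proof.
move=> tD; apply: eq_csum => r; rewrite /kmono /kcoef.
have [t0 _] := tD.
have -> : (d `^ v)%:C * cpow t v%:C / 2 = (d `^ v / 2)%:C * cpow t v%:C.
  by rewrite -half_dv; ring.
rewrite cpowM_real ?divr_gt0 ?cpow_neq0// (cpow_cpow _ tD) -half_dv.
have -> : 3 * k%:C / 2 = 3 / 2 * k%:C :> C by ring.
by rewrite mulrA.
Qed.

(** Both Gamma factors of the denominator are shifted by [GammaS], which asks for a positive real
    part; hence the condition, satisfied for all large r. *)
Lemma kmonoS t r : t != 0 -> 0 < Re (r%:R + l / k%:C + 3 / 2) ->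
  kmono t r.+1 = kmono t r * (- c / k%:C * ((d `^ v)%:C / 2) ^+ 2 * cpow t (v%:C * 2) /
    ((r%:R + l / k%:C + 3 / 2) * (r%:R + 3 / 2))).
Proof.
move=> t0 z0; rewrite /kmono /kcoef /kexp /kGamma.
have z1 : 0 < Re (r%:R + 3 / 2 : C).
  have -> : (3 / 2 : C) = (3 / 2)%:C by rewrite real_complexM real_complexV !real_complex_nat.
  by rewrite cReD Re_nat/= ltr_wpDl// divr_gt0.
set z := r%:R + l / k%:C + 3 / 2 in z0 *.
set y := r%:R + 3 / 2 in z1 *.
have -> : (r%:R * k%:C + l + 3 / 2 * k%:C) / k%:C = z by rewrite /z; field.
have -> : (r.+1%:R * k%:C + l + 3 / 2 * k%:C) / k%:C = z + 1.
  by rewrite /z -natr1; field.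
have -> : r.+1%:R + 3 / 2 = y + 1 by rewrite /y -natr1; ring.
rewrite (GammaS z0) (GammaS z1).
have -> : z + 1 - 1 = z - 1 + 1 by ring.
rewrite (cpowD _ _ kC0) (cpowr1 kC0).
set w := 2 * r%:R + l / k%:C + 1.
have -> : 2 * r.+1%:R + l / k%:C + 1 = w + 2%:R by rewrite /w -natr1; ring.
rewrite (cpowD _ _ half_dv0) (cpow_nat _ half_dv0) mulrDr (cpowD _ _ t0) exprS.
rewrite !invfM; ring.
Qed.

(** Ratio test from the rank where r >= - Re l / k: of the two factors in the denominator of
    [kmonoS], one then has modulus at least 1 and the other at least r + 1. *)
Lemma cvg_kmono t : t != 0 -> cvgn (series (fun r => normc (kmono t r))).
Proof.
move=> t0; set W := - c / k%:C * ((d `^ v)%:C / 2) ^+ 2 * cpow t (v%:C * 2).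
apply: (@ratio_cvg_series _ _ (fun r => normc W / r.+1%:R)).
- by move=> r; exact: normc_ge0.
- near=> r.
  have h32 : (3 / 2 : C) = (3 / 2)%:C by rewrite real_complexM real_complexV !real_complex_nat.
  have rl : - (Re l / k) <= r%:R by near: r; exact: nbhs_infty_ger.
  have z1 : 1 <= Re (r%:R + l / k%:C + 3 / 2).
    by rewrite h32 !cReD Re_nat Re_lk /=; lra.
  rewrite kmonoS//; last exact: lt_le_trans z1.
  rewrite -/W Normc.normcM mulrC ler_wpM2r ?normc_ge0//.
  rewrite Normc.normcM ler_wpM2l ?normc_ge0// Normc.normcV Normc.normcM.
  have n1 : 1 <= normc (r%:R + l / k%:C + 3 / 2).
    by rewrite (le_trans z1)// (le_trans (ler_norm _))// ler_Re_normc.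
  have n2 : r.+1%:R <= normc (r%:R + 3 / 2 : C).
    rewrite (le_trans _ (ler_Re_normc _))// (le_trans _ (ler_norm _))//.
    rewrite h32 cReD Re_nat /= -natr1; lra.
  have r0 : 0 < r.+1%:R :> R by rewrite ltr0n.
  rewrite lef_pV2 ?posrE//; last first.
    by rewrite mulr_gt0// (lt_le_trans _ n1, lt_le_trans _ n2).
  by rewrite -[leLHS]mul1r ler_pM// ltW.
- rewrite -[X in _ --> X](mulr0 (normc W)); apply: cvgMl_tmp.
  exact: cvg_harmonic.
Unshelve. all: by end_near. Qed.

Let P0_gt : -1 < P0. Proof. exact: l_int. Qed.

(** The numerator Gamma (p_r + 1) is absorbed into the Mittag-Leffler coefficients, leaving the
    [mlq], which are bounded uniformly in r. *)
Lemma kinetic_termE t r :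
  kinetic_term k d v a c l t r = kmono t r * fracend v kexp (karg t) r.
Proof.
have bP : P0 + 1 <= Re (kexp r + 1) by rewrite cReD lerD2r.
have b0 : 0 < Re (kexp r + 1).
  by apply: lt_le_trans bP; rewrite -ltrBlDr sub0r.
rewrite /fracend.
have sq := @csummable_mlq _ _ _ v_gt0 P0_gt (kexp r + 1) (karg t) bP.
have -> : csum (fun n => mlq v (kexp r + 1) n * karg t ^+ n) =
    Gamma (kexp r + 1) * MittagLeffler v%:C (kexp r + 1) (karg t).
  have g0 := Gamma_neq0 b0.
  have e n : mlq v (kexp r + 1) n * karg t ^+ n =
      Gamma (kexp r + 1) * (karg t ^+ n / Gamma (v%:C * n%:R + (kexp r + 1))).
    by rewrite /mlq; ring.
  (* Pulling out the constant needs summability of the plain Mittag-Leffler series; it is inherited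
     from [mlq] on dividing by the nonzero Gamma value. *)
  have sb : csummable (fun n => karg t ^+ n / Gamma (v%:C * n%:R + (kexp r + 1))).
    apply: cvg_csummable (_ : series (_ : nat -> C^o) @ \oo -->
      ((Gamma (kexp r + 1))^-1 * csum (fun n => mlq v (kexp r + 1) n * karg t ^+ n) : C^o)).
    apply: eq_seq_cvg (csummableZ (x := (Gamma (kexp r + 1))^-1) sq) => n.
    by congr (series _ n); apply/funext => m; rewrite e mulKf.
  by rewrite (eq_csum e); exact: csumZ sb.
rewrite /kinetic_term /kmono /kcoef -/(kexp r) /karg.
have -> : 2 * r%:R * v%:C + v%:C * (l / k%:C) + v%:C + 1 = kexp r + 1.
  by rewrite /kexp; ring.
have -> : 2 * r%:R * v%:C + l / k%:C * v%:C + v%:C + 1 = kexp r + 1.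
  by rewrite /kexp; ring.
ring.
Qed.

Let pow_scale u t : 0 < u -> t != 0 -> cpow (u%:C * t) v%:C = cpow t v%:C * (u `^ v)%:C.
Proof. by move=> u0 t0; rewrite cpowM_real// cpow_real// mulrC. Qed.

(** Powers of u t split because u > 0, which describes the whole segment from 0 to t by the fixed
    data [kmono t] and [karg t]. *)
Lemma kinetic_term_scale t u r : 0 < u -> t != 0 ->
  kinetic_term k d v a c l (u%:C * t) r = fracterm v (kmono t) kexp (karg t) r u.
Proof.
move=> u0 t0; rewrite kinetic_termE /fracterm.
have -> : fracend v kexp (karg (u%:C * t)) r =
    csum (fun n => mlq v (kexp r + 1) n * (karg t * (u `^ v)%:C) ^+ n).
  apply: eq_csum => n; congr (_ * _ ^+ _).
  by rewrite /karg (pow_scale u0 t0) mulrA.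
by congr (_ * _); rewrite /kmono (cpowM_real _ u0 t0); ring.
Qed.

Lemma csummable_kinetic_term t : t != 0 ->
  csummable (kinetic_term k d v a c l t).
Proof.
move=> t0.
have := csummable_fracend v_gt0 P0_gt (X := karg t) (cvg_kmono t0) Re_kexp.
by congr csummable; apply/funext => r; rewrite kinetic_termE.
Qed.

Definition kinetic_series t : C := N0 * csum (kinetic_term k d v a c l t).

Lemma RL_kernel_kinetic_series t u : t != 0 -> D u ->
  RL_kernel v kinetic_series t u =
  N0 * (((1 - u) `^ (v - 1))%:C *
    csum (fun r => fracterm v (kmono t) kexp (karg t) r u)).
Proof.
move=> t0 Du; rewrite /RL_kernel /kinetic_series mulrCA; congr (_ * (_ * _)).
by apply: eq_csum => r; rewrite kinetic_term_scale// (D_gt0 Du).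
Qed.

Lemma kinetic_series_solution t : principal_domain v t ->
  cintegrable D (RL_kernel v kinetic_series t) /\
  kinetic_series t - N0 * kStruve k l c ((d `^ v)%:C * cpow t v%:C) =
  - cpow a v%:C * RL_integral v%:C kinetic_series t.
Proof.
move=> tD; have [t0 _] := tD.
have fi := cintegrable_fracseries v_gt0 P0_gt (karg t) (cvg_kmono t0) Re_kexp.
have ki : cintegrable D (RL_kernel v kinetic_series t).
  have := cintegrableZ mD N0 fi.
  by apply: eq_cintegrable => // u Du; rewrite RL_kernel_kinetic_series.
split=> //; rewrite RL_integralE// kStruveE//.
rewrite (eq_cintegral (fun u Du => RL_kernel_kinetic_series t0 Du)) cintegralZ//.
have e := cintegral_fracseries v_gt0 P0_gt (karg t) (cvg_kmono t0) Re_kexp.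
have G0 : Gamma v%:C != 0 :> C by exact: Gamma_neq0.
rewrite /kinetic_series -mulrBr (eq_csum (kinetic_termE t)).
apply: (mulfI G0); rewrite mulrCA -e /karg.
set I := cintegral _ _; rewrite [RHS]mulrCA mulVKf//; ring.
Qed.

End KineticEquation.

Theorem theorem3 (R : realType) (k d v : R) (a c l N0 : R[i])
  (k_gt0 : 0 < k) (d_gt0 : 0 < d) (v_gt0 : 0 < v)
  (a_neq_d : a != d%:C)
  (l_gt : - (3 / 2) < complex.Re l)
  (l_int : -1 < v * (complex.Re l / k + 1)) :
  (forall t : R[i], principal_domain v t ->
     csummable (kinetic_term k d v a c l t)) /\
  (forall N : R[i] -> R[i],
     kinetic_solution k d v a c l N0 N <->
     (forall t : R[i], principal_domain v t ->
        N t = N0 * csum (kinetic_term k d v a c l t))).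
Proof.
split=> [t [t0 _]|N]; first exact: csummable_kinetic_term.
pose F := kinetic_series k d v a c l N0.
have F_sol t : principal_domain v t -> cintegrable `](0 : R), 1[ (RL_kernel v F t) /\
    F t - N0 * kStruve k l c ((d `^ v)%:C * cpow t v%:C) =
    - cpow a v%:C * RL_integral v%:C F t.
  exact: kinetic_series_solution.
have mD : measurable (`](0 : R), 1[%classic : set (measurableTypeR R)).
  exact: measurable_itv.
split=> [N_sol t tD|NF t tD]; last first.
  have [t0 _] := tD; have [Fi Feq] := F_sol t tD.
  (* The integral at t sees N only at points u t with u > 0, which stay in [principal_domain];
     agreement with [F] there is enough. *)
  have NFk u : 0 < u -> RL_kernel v N t u = RL_kernel v F t u.
    move=> u0; rewrite /RL_kernel NF//; exact: principal_domain_scale.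
  have Ni : cintegrable `](0 : R), 1[ (RL_kernel v N t).
    by apply: eq_cintegrable Fi => // u /D_gt0 u0; rewrite NFk.
  split; first exact/RL_definedP.
  rewrite NF// Feq; congr (_ * _); rewrite !RL_integralE//; congr (_ * (_ * _)).
  by apply: eq_cintegral => u /D_gt0 u0; rewrite NFk.
pose M z := N z - F z.
have M_hom z : principal_domain v z -> cintegrable `](0 : R), 1[ (RL_kernel v M z) /\
    M z = (- cpow a v%:C / Gamma v%:C) *
      (cpow z v%:C * cintegral `](0 : R), 1[ (RL_kernel v M z)).
  move=> zD; have [z0 _] := zD; have [Fi Feq] := F_sol z zD.
  have [/(RL_definedP _ _ z0) Ni Neq] := N_sol z zD.
  have Mk u : RL_kernel v N z u - RL_kernel v F z u = RL_kernel v M z u.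
    by rewrite /RL_kernel -mulrBr.
  have Mi : cintegrable `](0 : R), 1[ (RL_kernel v M z).
    have := cintegrableD mD Ni (cintegrableZ mD (-1) Fi).
    by apply: eq_cintegrable => // u _; rewrite mulN1r Mk.
  split=> //; rewrite -(eq_cintegral (fun u _ => Mk u)) (cintegralB mD Ni Fi).
  have -> : M z = - cpow a v%:C * RL_integral v%:C N z -
                  - cpow a v%:C * RL_integral v%:C F z.
    by rewrite -Neq -Feq /M; ring.
  by rewrite !RL_integralE//; ring.
(* [homogeneous_eq0] gives the value at half of its point, so it is applied to 2 t. *)
have M_scale s : 0 < s -> principal_domain v (s%:C * (2%:C * t)).
  by move=> s0; do 2 apply: principal_domain_scale => //.
have [t0 _] := tD.
have t1_neq0 : 2%:C * t != 0 by rewrite mulf_neq0// real_complex_eq0.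
have := @homogeneous_eq0 _ v v_gt0 M (2%:C * t) (- cpow a v%:C / Gamma v%:C) t1_neq0
  (fun s hs => (M_hom _ (M_scale s (andP hs).1)).1)
  (fun s hs => (M_hom _ (M_scale s (andP hs).1)).2).
rewrite mulrA -real_complexM mulVf ?pnatr_eq0// mul1r => /eqP.
by rewrite subr_eq0 => /eqP.
Qed.
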